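(* Let $v,w\in I(d,n)$ with $v\le w$ and let $m\ge0$. For a monomial $\mathfrak S$ in $\mathfrak R^v$, let $\mathfrak S_+$ be its part (with multiplicities) in $\mathfrak N^v$ and $\mathfrak S_-$ its part in $\mathfrak R^v\setminus\mathfrak N^v$; let $\mathfrak S_-^*$ be the monomial in $\mathfrak N^{v^*}$ obtained from $\mathfrak S_-$ by replacing each $(r,c)$ by $(r^*,c^* )$. Write $\tilde\pi_v(\mathfrak S_+)=(\theta_1\ge\dots\ge\theta_p)$ and $\tilde\pi_{v^*}(\mathfrak S_-^* )=(\mu_1\ge\dots\ge\mu_q)$. Then $$\mathfrak S\longmapsto \big(\theta_1\ge\dots\ge\theta_p\ge\mu_q^*\ge\dots\ge\mu_1^*\big)$$ is a (well-defined) bijection from $S^v_w(m)$, the set of $w$-dominated monomials of degree $m$ in $\mathfrak R^v$, onto $SM^v_w(m)$, the set of $w$-dominated $v$-compatible standard monomials of degree $m$.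
   Context: Fix positive integers $d\le n$. $I(d,n)$ is the set of $d$-element subsets of $\{1,\dots,n\}$, written $v=(v_1<\dots<v_d)$, with partial order $v\le w$ iff $v_i\le w_i$ for all $i$. For an integer $x$ with $1\le x\le n$ put $x^*=n-x+1$; for $v\in I(d,n)$ put $v^*=(v_d^*,\dots,v_1^* )$. The $v$-degree of $\theta\in I(d,n)$ is the cardinality of $\theta\setminus v$. Standard monomials: a standard monomial is a finite (possibly empty) multiset of elements of $I(d,n)$ that can be arranged as $\theta_1\ge\dots\ge\theta_t$. It is $w$-dominated if $w\ge\theta_1$ (the empty one is $w$-dominated), and $v$-compatible if each $\theta_i$ is comparable with $v$ and none equals $v$. Its degree is the sum of the $v$-degrees of the $\theta_i$. Chains and domination: $\mathfrak R^v=\{(r,c): r\in\{1,\dots,n\}\setminus v,\ c\in v\}$, $\mathfrak N^v=\{(r,c)\in\mathfrak R^v: r>c\}$. A monomial in a set is a finite multiset of its elements; its degree is its cardinality with multiplicity. For $(r_1,c_1),(r_2,c_2)\in\mathfrak N^v$ write $(r_1,c_1)>(r_2,c_2)$ if $r_1>r_2$ and $c_1<c_2$. A $v$-chain is a (possibly empty) sequence $\beta_1>\dots>\beta_t$ in $\mathfrak N^v$; with $\beta_i=(r_i,c_i)$, $s_{\beta_1}\cdots s_{\beta_t}v=(v\setminus\{c_1,\dots,c_t\})\cup\{r_1,\dots,r_t\}$. $w$ dominates the chain if $w\ge s_{\beta_1}\cdots s_{\beta_t}v$, and dominates a monomial $\mathfrak S$ in $\mathfrak R^v$ if it dominates every $v$-chain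 consisting of elements of $\mathfrak S\cap\mathfrak N^v$. The map $\pi$ (for given $v$): let $\mathfrak S$ be a non-empty monomial in $\mathfrak N^v$. For $j\ge1$ let $\mathfrak S_j$ consist (with multiplicities) of the elements $\beta$ of $\mathfrak S$ that are the last element of a $v$-chain of length $j$ in $\mathfrak S$ but not of one of length $j+1$. No two distinct elements of $\mathfrak S_j$ are comparable, so the elements of $\mathfrak S_j$, listed with multiplicities, can be arranged so that both row numbers $r$ and column numbers $c$ are non-decreasing. Two consecutive members $(r,c),(R,C)$ of this arrangement are related if $r>C$; the blocks of $\mathfrak S_j$ are the classes of the equivalence relation generated. For a block $\mathfrak B$ with arrangement $(r_1,c_1),\dots,(r_p,c_p)$ put $w(\mathfrak B)=(r_p,c_1)$ and $\mathfrak B'=\{(r_1,c_2),(r_2,c_3),\dots,(r_{p-1},c_p)\}$ (a multiset of $p-1$ elements). Let $\mathfrak S'$ be the union (with multiplicities) of $\mathfrak B'$ over all blocks of all $\mathfrak S_j$, and let $u\in I(d,n)$ be obtained from $v$ by deleting the column indices and adding the row indices of all the $w(\mathfrak B)$ (these row indices are pairwise distinct, as are the column indices). Then $\pi(\mathfrak S)=(u,\mathfrak S')$; the degree of $\mathfrak S'$ is smaller than that of $\mathfrak S$. The map $\tilde\pi_v$: defined recursively on monomials in $\mathfrak N^v$ by sending the empty monomial to the empty monomial and, for $\mathfrak S$ non-empty with $\pi(\mathfrak S)=(u,\mathfrak S')$, $\tilde\pi_v(\mathfrak S)=(u\ge\tilde\pi_v(\mathfrak S'))$, i.e. $u$ followed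 by the sequence $\tilde\pi_v(\mathfrak S')$. $\tilde\pi_{v^*}$ is the same map with $v^*$ in place of $v$. *)

(* Defs.v *)
From mathcomp Require Import all_boot finmap multiset.
From mathcomp Require Import classical_sets functions.

Set Implicit Arguments.
Unset Strict Implicit.
Unset Printing Implicit Defensive.

Local Open Scope nat_scope.
Local Open Scope mset_scope.

(* The ground set {1, ..., n} is modelled by 'I_n = {0, ..., n - 1}, i.e. all
   indices are shifted down by one; x |-> n - x + 1 then becomes rev_ord.
   Monomials, i.e. finite multisets, are elements of {mset _}; through the
   coercion to sequences, size S is the cardinality with multiplicity. *)

Definition Idn (d n : nat) : {set {set 'I_n}} := [set v : {set 'I_n} | #|v| == d].

(* enum lists the elements of a set of ordinals in increasing order. *)
Definition leI n (v w : {set 'I_n}) : bool :=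
  all2 (fun i j : 'I_n => i <= j) (enum v) (enum w).

Definition geI n (v w : {set 'I_n}) : bool := leI w v.

Definition star n (v : {set 'I_n}) : {set 'I_n} := [set rev_ord x | x in v].

Definition vdegree n (v theta : {set 'I_n}) : nat := #|theta :\: v|.

(* Standard monomials *)

Definition standard d n (T : {mset {set 'I_n}}) : Prop :=
  (forall theta, theta \in T -> theta \in Idn d n) /\
  (exists s : seq {set 'I_n}, perm_eq s T /\ sorted (@geI n) s).

Definition sm_dominated n (w : {set 'I_n}) (T : {mset {set 'I_n}}) : Prop :=
  forall (theta1 : {set 'I_n}) (s : seq {set 'I_n}),
    perm_eq (theta1 :: s) T -> sorted (@geI n) (theta1 :: s) -> leI theta1 w.

Definition sm_compatible n (v : {set 'I_n}) (T : {mset {set 'I_n}}) : Prop :=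
  forall theta, theta \in T -> (leI theta v || leI v theta) && (theta != v).

Definition sm_degree n (v : {set 'I_n}) (T : {mset {set 'I_n}}) : nat :=
  \sum_(theta <- T) vdegree v theta.

Definition SM d n (v w : {set 'I_n}) (m : nat) : set {mset {set 'I_n}} :=
  fun T => [/\ standard d T, sm_dominated w T, sm_compatible v T
             & sm_degree v T = m].

(* Monomials in R^v; a pair is (row, column). *)

Notation cell n := ('I_n * 'I_n)%type.

Definition Rset n (v : {set 'I_n}) : {set cell n} :=
  [set b : cell n | (b.1 \notin v) && (b.2 \in v)].

Definition Nset n (v : {set 'I_n}) : {set cell n} :=
  [set b in Rset v | b.2 < b.1].

Definition cell_gt n (a b : cell n) : bool := (b.1 < a.1) && (a.2 < b.2).

Definition vchain n (v : {set 'I_n}) (s : seq (cell n)) : bool :=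
  all (mem (Nset v)) s && sorted (@cell_gt n) s.

(* Delete the columns of the cells in s from v and add their rows; on a
   v-chain this is s_{beta_1} ... s_{beta_t} v. *)
Definition swap n (v : {set 'I_n}) (s : seq (cell n)) : {set 'I_n} :=
  (v :\: [set:: [seq b.2 | b <- s]]) :|: [set:: [seq b.1 | b <- s]].

Definition dominates n (v w : {set 'I_n}) (S : {mset cell n}) : Prop :=
  forall s : seq (cell n),
    vchain v s -> (forall b, b \in s -> b \in S) -> leI (swap v s) w.

Definition Smon n (v w : {set 'I_n}) (m : nat) : set {mset cell n} :=
  fun S => [/\ forall b, b \in S -> b \in Rset v, size S = m
             & dominates v w S].

(* The map pi *)

Definition ends_chain n (v : {set 'I_n}) (S : {mset cell n}) (j : nat)
    (b : cell n) : bool :=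
  (0 < j) &&
  [exists t : j.-tuple (cell n),
     [&& vchain v t, all (fun a => a \in S) t & last b t == b]].

(* The sublist keeps the multiplicities of S. *)
Definition layer n (v : {set 'I_n}) (S : {mset cell n}) (j : nat)
    : seq (cell n) :=
  [seq b <- S | ends_chain v S j b && ~~ ends_chain v S j.+1 b].

(* On a layer of a monomial in N^v this relation is total, so sorting makes
   both the rows and the columns non-decreasing; being antisymmetric, it makes
   the result independent of the enumeration of S. *)
Definition cell_le n (a b : cell n) : bool := (a.1 <= b.1) && (a.2 <= b.2).

Definition arranged n (v : {set 'I_n}) (S : {mset cell n}) (j : nat)
    : seq (cell n) := sort (@cell_le n) (layer v S j).

Definition related n (a b : cell n) : bool := b.2 < a.1.

(* The classes of the equivalence relation generated by `related` on
   consecutive members of s: s is cut exactly between those consecutive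
   members that are not related. *)
Fixpoint blocks n (s : seq (cell n)) : seq (seq (cell n)) :=
  if s is a :: s' then
    match blocks s' with
    | (b :: B) :: Bs =>
        if related a b then (a :: b :: B) :: Bs else [:: a] :: (b :: B) :: Bs
    | _ => [:: [:: a]]
    end
  else [::].

(* w(B) = (r_p, c_1), as an option because the empty list has no value;
   blocks are never empty. *)
Definition block_w n (B : seq (cell n)) : option (cell n) :=
  if B is b :: B' then Some ((last b B').1, b.2) else None.

Definition block_prime n (B : seq (cell n)) : seq (cell n) :=
  [seq (p.1.1, p.2.2) | p <- zip B (behead B)].

(* A v-chain in S has at most size S elements, so that the layers of index
   greater than size S are empty. *)
Definition all_blocks n (v : {set 'I_n}) (S : {mset cell n})
    : seq (seq (cell n)) :=
  flatten [seq blocks (arranged v S j) | j <- iota 1 (size S)].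

Definition pi_map n (v : {set 'I_n}) (S : {mset cell n})
    : {set 'I_n} * {mset cell n} :=
  (swap v (pmap (@block_w n) (all_blocks v S)),
   seq_mset (flatten [seq block_prime B | B <- all_blocks v S])).

(* The degree of the second component of pi_map v S is smaller than that of S
   when S is non-empty, so size S recursive calls suffice. *)
Fixpoint pi_tilde_rec n (k : nat) (v : {set 'I_n}) (S : {mset cell n})
    : seq {set 'I_n} :=
  if k is k'.+1 then
    if S == mset0 then [::]
    else (pi_map v S).1 :: pi_tilde_rec k' v (pi_map v S).2
  else [::].

Definition pi_tilde n (v : {set 'I_n}) (S : {mset cell n}) : seq {set 'I_n} :=
  pi_tilde_rec (size S) v S.

(* The bijection *)

Definition pos_part n (v : {set 'I_n}) (S : {mset cell n}) : {mset cell n} :=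
  seq_mset [seq b <- S | b \in Nset v].

Definition neg_part n (v : {set 'I_n}) (S : {mset cell n}) : {mset cell n} :=
  seq_mset [seq b <- S | b \in Rset v :\: Nset v].

Definition star_mon n (S : {mset cell n}) : {mset cell n} :=
  seq_mset [seq (rev_ord b.1, rev_ord b.2) | b <- S].

(* (theta_1, ..., theta_p, mu_q^*, ..., mu_1^* ) *)
Definition main_seq n (v : {set 'I_n}) (S : {mset cell n}) : seq {set 'I_n} :=
  pi_tilde v (pos_part v S) ++
  rev [seq star mu | mu <- pi_tilde (star v) (star_mon (neg_part v S))].

(* Main.v *)
Require Import Defs.
From mathcomp Require Import all_boot finmap multiset.
From mathcomp Require Import classical_sets functions.
From mathcomp Require Import zify.

(* Let [depth a b] be the length of a longest v-chain in the part of S with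
   columns < a and rows >= b.  Writing S' for the second component of pi_map v S,
   [mass_pi_map] says that for a <= b this part of S has [depth a b] more cells
   than the corresponding part of S', and [cnt_pi_map] says that the values
   [depth x x] on the diagonal encode the first component u of pi_map v S (they
   are the numbers |v /\ [0,x)| - |u /\ [0,x)|).  These are the first rows of
   the Fomin growth diagram of S on the staircase of N^v: with
     lam = depth c r.+1, mu = depth c.+1 r.+1, nu = depth c r, rho = depth c.+1 r,
   the multiplicities k, k' of (r, c) in S, S' satisfy
     rho = max (mu, nu, lam + 1 if k > 0),  k + mu + nu = k' + rho + lam,
   and this local rule can be solved for (lam, k) as well.  Propagating it from
   the diagonal towards the corner recovers S from (u, S'), which gives
   injectivity of pi_map; propagating it from an arbitrary u > v and S' gives a
   preimage, where u >= v S' (domination) keeps all values nonnegative.  Since w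
   dominates S iff depth x x <= |v /\ [0,x)| - |w /\ [0,x)| for all x, that is, iff
   u <= w, the recursion builds weakly decreasing sequences. *)

Set Implicit Arguments.
Unset Strict Implicit.
Unset Printing Implicit Defensive.

Local Open Scope nat_scope.
Local Open Scope mset_scope.

(** * The order on subsets in terms of counting functions *)

Definition cnt n (A : {set 'I_n}) (x : nat) : nat :=
  count (fun i : 'I_n => i < x) (enum A).

(** From counts to entries: the threshold [b.+1], with [b] the head of [t], forces the heads to be
    in order. Thresholds above [b] count both heads, and the others count nothing in [t], so the
    hypothesis passes to the tails. *)
Lemma all2_leq_count (s t : seq nat) :
  sorted ltn s -> sorted ltn t -> size s = size t ->
  reflect (forall x, count (fun i => i < x) t <= count (fun i => i < x) s)
          (all2 leq s t).
Proof.
have count0 a x u : path ltn a u -> x <= a -> count (fun i => i < x) u = 0.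
  move=> pu le_xa; apply/eqP; rewrite -leqn0 leqNgt -has_count.
  apply/hasPn => i iu; have := order_path_min ltn_trans pu.
  by move/allP/(_ i iu) => /=; lia.
move=> ss st Est; apply: (iffP idP).
  elim: s t Est {ss st} => [|a s IH] [|b t] //= [/IH{}IH] /andP[le_ab st] x.
  by have := IH st x; lia.
elim: s t ss st Est => [|a s IH] [|b t] //= pa pb [eq_st] H.
have le_ab : a <= b.
  have := H b.+1; rewrite ltnSn; case: (ltnP a b.+1) => //= lt_ba.
  by rewrite (count0 a _ s) //; lia.
rewrite le_ab /=; apply: IH; rewrite ?(path_sorted pa) ?(path_sorted pb) // => x.
have [le_xb|lt_bx] := leqP x b; first by rewrite (count0 b _ t).
by have := H x; rewrite lt_bx (leq_ltn_trans le_ab lt_bx).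
Qed.

Section Sets.
Variable n : nat.
Implicit Types (A B v w : {set 'I_n}) (x : nat).

Lemma sorted_enum_val A : sorted ltn (map val (enum A)).
Proof.
have -> : enum A = filter (mem A) (enum 'I_n) by rewrite enumT.
rewrite sorted_map; apply: sorted_filter => [j i k|]; first exact: ltn_trans.
by rewrite -sorted_map val_enum_ord iota_ltn_sorted.
Qed.

(** Larger sets have fewer elements below each [x]. In this form the order can be compared with
    depths, which are differences of such counts ([cnt_pi_map]). *)
Lemma leIP v w :
  reflect (#|v| = #|w| /\ forall x, cnt w x <= cnt v x) (leI v w).
Proof.
have -> : leI v w = all2 leq (map val (enum v)) (map val (enum w)).
  by rewrite /leI; elim: (enum v) (enum w) => [|i s IH] [|j t] //=; rewrite IH.
have cntE A x : cnt A x = count (fun i => i < x) (map val (enum A)).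
  by rewrite count_map.
have sz A : size (map val (enum A)) = #|A| by rewrite size_map cardE.
have [eq_vw|ne_vw] := eqVneq #|v| #|w|.
  apply: (iffP (all2_leq_count _ _ _)); rewrite ?sorted_enum_val ?sz //.
    by move=> H; split=> // x; rewrite !cntE.
  by case=> _ H x; rewrite -!cntE.
apply: (iffP idP) => [|[/eqP]]; last by rewrite (negPf ne_vw).
by rewrite all2E !sz (negPf ne_vw).
Qed.

Lemma cnt0 A : cnt A 0 = 0. Proof. by rewrite /cnt; elim: (enum A). Qed.

Lemma cnt_ord A : cnt A n = #|A|.
Proof. by rewrite cardE -count_predT; apply: eq_count => i; rewrite ltn_ord. Qed.

Lemma cntS A (i : 'I_n) : cnt A i.+1 = cnt A i + (i \in A).
Proof.
rewrite -mem_enum -(count_uniq_mem _ (enum_uniq _)) /cnt.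
elim: (enum A) => //= j s ->; have -> : (j == i) = (j == i :> nat) by [].
lia.
Qed.

Lemma cntSn A x (lt_xn : x < n) : cnt A x.+1 = cnt A x + (Ordinal lt_xn \in A).
Proof. exact: (cntS A (Ordinal lt_xn)). Qed.

Lemma cnt_big A x : n <= x -> cnt A x = #|A|.
Proof.
move=> le_nx; rewrite cardE -count_predT; apply: eq_count => i.
exact: leq_trans (ltn_ord i) le_nx.
Qed.

Lemma cnt_inj A B : (forall x, x <= n -> cnt A x = cnt B x) -> A = B.
Proof.
move=> H; apply/setP=> i; have := cntS A i; have := cntS B i.
have := ltn_ord i => lt_in.
rewrite !H; [|lia|lia] => ->; case: (i \in A); case: (i \in B) => //; lia.
Qed.

Lemma leI_cntP v w : #|v| = #|w| ->
  reflect (forall x, x <= n -> cnt w x <= cnt v x) (leI v w).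
Proof.
move=> eq_vw; apply: (iffP (leIP _ _)) => [[_ H] x _ //|H]; split=> // x.
have [/H//|lt_nx] := leqP x n.
by rewrite !cnt_big ?eq_vw // ltnW.
Qed.

Lemma leI_card v w : leI v w -> #|v| = #|w|.
Proof. by case/leIP. Qed.

Lemma leI_trans : transitive (@leI n).
Proof.
move=> v u w /leIP[Euv Huv] /leIP[Evw Hvw]; apply/leIP; split; first lia.
by move=> x; apply: leq_trans (Hvw x) (Huv x).
Qed.

Lemma geI_trans : transitive (@geI n).
Proof. by move=> v u w Huv Hvw; apply: leI_trans Hvw Huv. Qed.

Lemma leI_anti : antisymmetric (@leI n).
Proof.
move=> v w /andP[/leIP[_ Hvw] /leIP[_ Hwv]]; apply: cnt_inj => x _.
by apply/eqP; rewrite eqn_leq Hvw Hwv.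
Qed.

Lemma geI_anti : antisymmetric (@geI n).
Proof. by move=> v w; rewrite andbC => /leI_anti. Qed.

Lemma mem_star v (i : 'I_n) : (rev_ord i \in star v) = (i \in v).
Proof. by rewrite (mem_imset _ _ (can_inj (@rev_ordK n))). Qed.

Lemma starK : involutive (@star n).
Proof. by move=> v; apply/setP=> i; rewrite -[i in LHS]rev_ordK !mem_star. Qed.

Lemma card_star v : #|star v| = #|v|.
Proof. exact: card_imset (can_inj (@rev_ordK n)). Qed.

(** Reversal matches the elements of [star v] below [x] with the elements of [v] that are at least
    [n - x]. *)
Lemma cnt_star v x : x <= n -> cnt (star v) x + cnt v (n - x) = #|v|.
Proof.
elim: x => [|x IH] le_xn; first by rewrite cnt0 subn0 cnt_ord.
rewrite -IH ?(ltnW le_xn) // (cntSn _ le_xn).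
have -> : n - x = (rev_ord (Ordinal le_xn)).+1 by rewrite /=; lia.
by rewrite cntS -(mem_star v) rev_ordK addnAC addnA.
Qed.

Lemma leI_star v w : leI (star v) (star w) = leI w v.
Proof.
have sub (a b : {set 'I_n}) : leI a b -> leI (star b) (star a).
  case/leIP=> eq_ab H.
  apply/leI_cntP; rewrite ?card_star // => x le_xn.
  have := cnt_star a le_xn; have := cnt_star b le_xn; have := H (n - x); lia.
by apply/idP/idP => /sub; rewrite ?starK.
Qed.

Lemma vdegree_star v w : vdegree (star v) (star w) = vdegree v w.
Proof.
rewrite /vdegree -(card_star (w :\: v)).
suff -> : star w :\: star v = star (w :\: v) by [].
by apply/setP=> i; rewrite -[i]rev_ordK inE !mem_star inE.
Qed.

Lemma vdegree_eq0 v w : #|v| = #|w| -> (vdegree v w == 0) = (w == v).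
Proof.
move=> eq_vw; rewrite cards_eq0 finset.setD_eq0.
by apply/idP/eqP => [sub_wv|-> //]; apply/eqP; rewrite eqEcard sub_wv eq_vw /=.
Qed.

End Sets.

(** * Chains, ranks and the depth function *)

Definition rect n (a b : nat) (x : cell n) : bool := (x.2 < a) && (b <= x.1).

(** The index of the layer containing [x], and 0 for [x] outside [S]. The bound [size S] is enough
    because the cells of a v-chain are distinct. *)
Definition rank n (v : {set 'I_n}) (S : {mset cell n}) (x : cell n) : nat :=
  \max_(j < (size S).+1 | ends_chain v S j x) j.

Definition depth n (v : {set 'I_n}) (S : {mset cell n}) (a b : nat) : nat :=
  \max_(x <- S | rect a b x) rank v S x.

Definition mass n (S : seq (cell n)) (a b : nat) : nat := count (rect a b) S.

Lemma ltn_bigmax (I : eqType) (s : seq I) (P : pred I) (F : I -> nat) m :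
  (m < \max_(i <- s | P i) F i) = has (fun i => P i && (m < F i)) s.
Proof.
apply/idP/hasP => [|[i si /andP[Pi ltm]]]; last first.
  exact: leq_trans ltm (leq_bigmax_seq i si Pi).
rewrite ltnNge => /negP H; apply/hasP; apply: contraT => /hasPn Hn; case: H.
apply/bigmax_leqP_seq => i si Pi; have := Hn i si.
by rewrite Pi -leqNgt.
Qed.

Lemma sorted_rcons2 (T : Type) (e : rel T) (s : seq T) (y x : T) :
  sorted e (rcons (rcons s y) x) = sorted e (rcons s y) && e y x.
Proof. by case: s => [|z s] /=; rewrite ?andbT // rcons_path last_rcons. Qed.

Section Chains.
Variables (n : nat) (v : {set 'I_n}) (S : {mset cell n}).
Hypothesis SN : {subset S <= Nset v}.
Implicit Types (x y : cell n) (i j a b : nat).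

Lemma cell_gt_trans : transitive (@cell_gt n).
Proof. by move=> y x z /andP[? ?] /andP[? ?]; apply/andP; split; lia. Qed.

Lemma cell_gt_irr : irreflexive (@cell_gt n).
Proof. by move=> x; rewrite /cell_gt ltnn. Qed.

Lemma cell_gt_rect x y : cell_gt y x = rect x.2 x.1.+1 y.
Proof. by rewrite /cell_gt /rect andbC. Qed.

Lemma ends_chain_rcons j x :
  ends_chain v S j.+1 x <->
  exists s, [/\ size s = j, sorted (@cell_gt n) (rcons s x)
              & {subset rcons s x <= S}].
Proof.
split=> [/existsP[[t szt]] /and3P[/andP[_ /= srt] /= /allP St /eqP lt]|].
  move/eqP: szt srt St lt; case/lastP: t => [|s y] //=.
  by rewrite size_rcons last_rcons => -[sz] srt St <-; exists s; split.
case=> s [sz srt sub]; apply/existsP.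
have szt : size (rcons s x) == j.+1 by rewrite size_rcons sz.
exists (Tuple szt); rewrite /vchain /= srt last_rcons eqxx !andbT.
by apply/andP; split; apply/allP=> y /sub //; apply: SN.
Qed.

Lemma ends_chain1 x : ends_chain v S 1 x = (x \in S).
Proof.
apply/idP/idP=> [/ends_chain_rcons[s [_ _ sub]]|Sx].
  by apply: sub; rewrite mem_rcons inE eqxx.
by apply/ends_chain_rcons; exists [::]; split=> // y; rewrite inE => /eqP ->.
Qed.

Lemma ends_chainSS j x : ends_chain v S j.+2 x <->
  x \in S /\ exists y, [/\ y \in S, cell_gt y x & ends_chain v S j.+1 y].
Proof.
split=> [/ends_chain_rcons[s [sz srt sub]]|[Sx [y [Sy yx]]]].
  split; first by apply: sub; rewrite mem_rcons inE eqxx.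
  case/lastP: s sz srt sub => [|s y] //; rewrite size_rcons => -[sz] srt sub.
  exists y; split; first by apply: sub; rewrite mem_rcons inE mem_rcons inE eqxx orbT.
    by move: srt; rewrite sorted_rcons2 => /andP[].
  apply/ends_chain_rcons; exists s; split=> //.
    by move: srt; rewrite sorted_rcons2 => /andP[].
  by move=> z zs; apply: sub; rewrite mem_rcons inE zs orbT.
case/ends_chain_rcons=> s [sz srt sub]; apply/ends_chain_rcons.
exists (rcons s y); split; first by rewrite size_rcons sz.
  by rewrite sorted_rcons2 srt.
by move=> z; rewrite mem_rcons inE => /orP[/eqP ->|/sub].
Qed.

Lemma ends_chain_mem j x : ends_chain v S j x -> x \in S.
Proof.
case: j => [|j] // /ends_chain_rcons[s [_ _ sub]].
by apply: sub; rewrite mem_rcons inE eqxx.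
Qed.

Lemma ends_chainW j x : 0 < j -> ends_chain v S j.+1 x -> ends_chain v S j x.
Proof.
case: j => // j _; elim: j x => [|j IH] x.
  by rewrite ends_chain1 => /ends_chain_mem.
case/ends_chainSS=> Sx [y [Sy yx /IH ecy]]; apply/ends_chainSS; split=> //.
by exists y.
Qed.

Lemma ends_chain_le i j x :
  0 < i <= j -> ends_chain v S j x -> ends_chain v S i x.
Proof.
case/andP=> i0 /subnK <-; elim: (j - i) => // k IH; rewrite addSn => H.
by apply/IH/ends_chainW; first lia.
Qed.

Lemma ends_chain_size j x : ends_chain v S j x -> j <= size S.
Proof.
case: j => // j /ends_chain_rcons[s [<- srt sub]].
rewrite -(size_rcons s x); apply: uniq_leq_size => //.
exact: sorted_uniq cell_gt_trans cell_gt_irr _ srt.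
Qed.

Lemma leq_rank j x : 0 < j -> (j <= rank v S x) = ends_chain v S j x.
Proof.
move=> j0; apply/idP/idP => [|ec]; last first.
  have lt_jS : j < (size S).+1 by rewrite ltnS (ends_chain_size ec).
  exact: (leq_bigmax_cond (Ordinal lt_jS)).
case: j j0 => // j j0; rewrite /rank ltn_bigmax => /hasP[i _ /andP[eci ltji]].
by apply: ends_chain_le eci; lia.
Qed.

Lemma rank_le_size x : rank v S x <= size S.
Proof. by apply/bigmax_leqP => i _; rewrite -ltnS. Qed.

Lemma rank_gt0 x : (0 < rank v S x) = (x \in S).
Proof. by rewrite leq_rank // ends_chain1. Qed.

Lemma mem_layer j x : 0 < j -> (x \in layer v S j) = (rank v S x == j) && (x \in S).
Proof.
move=> j0; rewrite mem_filter -!leq_rank //; case: (x \in S); last by rewrite !andbF.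
by rewrite !andbT; lia.
Qed.

Lemma ltn_rankP j x : x \in S ->
  reflect (j = 0 \/ exists y, [/\ y \in S, cell_gt y x & j <= rank v S y])
          (j < rank v S x).
Proof.
move=> Sx; rewrite leq_rank //; case: j => [|j].
  by rewrite ends_chain1 Sx; left; left.
apply: (iffP idP) => [/ends_chainSS[_ [y [Sy yx ecy]]]|[//|[y [Sy yx ecy]]]].
  by right; exists y; rewrite leq_rank.
by apply/ends_chainSS; split=> //; exists y; rewrite -leq_rank.
Qed.

Lemma ltn_depthP j a b :
  reflect (exists x, [/\ x \in S, rect a b x & j < rank v S x])
          (j < depth v S a b).
Proof.
rewrite /depth ltn_bigmax; apply: (iffP hasP) => [[x Sx /andP[]]|[x [Sx rx ltj]]].
  by exists x.
by exists x => //; rewrite rx.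
Qed.

(** The cells greater than [x] are those with column below [x.2] and row at least [x.1.+1]; a
    longest chain ending at [x] is a longest chain in that rectangle followed by [x]. *)
Lemma rank_depth x : x \in S -> rank v S x = (depth v S x.2 x.1.+1).+1.
Proof.
move=> Sx; apply/eqP; rewrite eqn_leq; apply/andP; split.
  case E: (rank v S x) => [//|k]; rewrite ltnS.
  have /ltn_rankP-/(_ Sx) : k < rank v S x by rewrite E.
  case=> [->//|[y [Sy yx le_ky]]]; case: k le_ky {E} => // k le_ky.
  by apply/ltn_depthP; exists y; rewrite -cell_gt_rect.
apply/(ltn_rankP _ Sx).
case E: (depth v S x.2 x.1.+1) => [|k]; [by left|right].
have /ltn_depthP[y [Sy ry lt_ky]] : k < depth v S x.2 x.1.+1 by rewrite E.
by exists y; rewrite cell_gt_rect.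
Qed.

Lemma leq_nat (i j : nat) : (forall k, k < i -> k < j) -> i <= j.
Proof. by case: i => // i; apply. Qed.

Lemma sub_depth a b a' b' : {in S, subpred (rect a b) (rect a' b')} ->
  depth v S a b <= depth v S a' b'.
Proof.
move=> sub; apply: leq_nat => k /ltn_depthP[x [Sx rx ltk]].
by apply/ltn_depthP; exists x; split=> //; apply: sub.
Qed.

(** For the upper bound, the last cell but one of a chain in the larger rectangle has a strictly
    smaller column than the last, so it lies in the smaller rectangle: only one cell is lost. Rows
    behave likewise in [depthSr]. *)
Lemma depthSl a b : depth v S a b <= depth v S a.+1 b <= (depth v S a b).+1.
Proof.
apply/andP; split; first by apply: sub_depth => x _ /andP[? ?]; apply/andP; lia.
apply: leq_nat => -[//|k] /ltn_depthP[x [Sx /andP[? ?] /ltn_rankP-/(_ Sx)]].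
case=> // -[y [Sy /andP[? ?] ltk]]; rewrite ltnS.
by apply/ltn_depthP; exists y; split=> //; apply/andP; lia.
Qed.

Lemma depthSr a b : depth v S a b.+1 <= depth v S a b <= (depth v S a b.+1).+1.
Proof.
apply/andP; split; first by apply: sub_depth => x _ /andP[? ?]; apply/andP; lia.
apply: leq_nat => -[//|k] /ltn_depthP[x [Sx /andP[? ?] /ltn_rankP-/(_ Sx)]].
case=> // -[y [Sy /andP[? ?] ltk]]; rewrite ltnS.
by apply/ltn_depthP; exists y; split=> //; apply/andP; lia.
Qed.

(** Every cell of the rectangle other than [(r, c)] lies in one of the two smaller rectangles of the
    inner [maxn]; the rank of [(r, c)] itself, when present, is given by [rank_depth]. *)
Lemma depth_rec (r c : 'I_n) :
  depth v S c.+1 r =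
  maxn (maxn (depth v S c.+1 r.+1) (depth v S c r))
       (if (r, c) \in S then (depth v S c r.+1).+1 else 0).
Proof.
apply/eqP; rewrite eqn_leq; apply/andP; split; last first.
  rewrite !geq_max; have /andP[_ _] := depthSr c.+1 r.
  have /andP[-> _] := depthSr c.+1 r; have /andP[-> _] := depthSl c r => /=.
  case: ifP => // Src; rewrite -(rank_depth Src).
  apply: leq_nat => k ltk; apply/ltn_depthP; exists (r, c); split=> //.
  by rewrite /rect /= !leqnn.
apply: leq_nat => k /ltn_depthP[x [Sx rx ltk]]; rewrite !leq_max.
have [rx'|nrx] := boolP (rect c.+1 r.+1 x).
  by rewrite (_ : k < depth v S c.+1 r.+1) //; apply/ltn_depthP; exists x.
have [rx'|nrx'] := boolP (rect c r x).
  by rewrite (_ : k < depth v S c r) ?orbT //; apply/ltn_depthP; exists x.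
have Ex : x = (r, c).
  case: x rx nrx nrx' {Sx ltk} => xr xc; rewrite /rect /= => rx nrx nrx'.
  by congr pair; apply: val_inj => /=; lia.
by rewrite Ex in Sx ltk *; rewrite Sx -(rank_depth Sx) ltk !orbT.
Qed.

Lemma depth0 b : depth v S 0 b = 0.
Proof. by apply/eqP; rewrite -leqn0; apply: leq_nat => k /ltn_depthP[x []]. Qed.

Lemma depthn a b : n <= b -> depth v S a b = 0.
Proof.
move=> le_nb; apply/eqP; rewrite -leqn0; apply: leq_nat => k.
by case/ltn_depthP=> x [_ /andP[_]]; have := ltn_ord x.1; lia.
Qed.

(* No cell of S lies in column x if x is not in v, nor in row x if x is in v. *)
Lemma depth_off (x : nat) : x < n ->
  depth v S x x.+1 = minn (depth v S x x) (depth v S x.+1 x.+1).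
Proof.
move=> lt_xn; have /andP[le1 _] := depthSr x x; have /andP[le2 _] := depthSl x x.+1.
apply/eqP; rewrite eqn_leq leq_min le1 le2 /= geq_min.
have [vx|vx] := boolP (Ordinal lt_xn \in v); apply/orP; [left|right].
  apply: sub_depth => y /SN; rewrite !inE => /andP[/andP[yv _] _] /andP[ltx lty].
  rewrite /rect ltx /= ltn_neqAle lty andbT; apply: contra yv => /eqP Ey.
  by rewrite (_ : y.1 = Ordinal lt_xn) //; apply: val_inj.
apply: sub_depth => y /SN; rewrite !inE => /andP[/andP[_ yv] _] /andP[lty ?].
apply/andP; split=> //; rewrite ltn_neqAle -ltnS lty andbT.
apply: contraNneq vx => Ey.
by rewrite (_ : Ordinal lt_xn = y.2) //; apply: val_inj.
Qed.

(** From a cell of rank above [j] one can pass to a greater cell of rank at least [j]. This stays in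
    the rectangle and lowers the rank, so rank exactly [j] is reached. *)
Lemma has_rect_layer j a b : 0 < j ->
  has (rect a b) (layer v S j) = (j <= depth v S a b).
Proof.
move=> j0; apply/hasP/idP => [[x]|].
  rewrite mem_layer // => /andP[/eqP <- Sx] rx; rewrite rank_depth //.
  by apply/ltn_depthP; exists x; rewrite rank_depth.
rewrite -(prednK j0) => /ltn_depthP[x [Sx rx]].
rewrite (prednK j0).
have [k] := ubnP (rank v S x); elim: k x Sx rx => // k IH x Sx rx ltk.
rewrite leq_eqVlt => /orP[/eqP Ej|].
  by exists x => //; rewrite mem_layer // Sx Ej eqxx.
case/(ltn_rankP _ Sx)=> [Ej|[y [Sy yx lejy]]]; first by rewrite Ej in j0.
have lt_yx : rank v S y < rank v S x by apply/ltn_rankP => //; right; exists y.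
apply: (IH y) => //; last by lia.
by move: rx yx => /andP[? ?] /andP[? ?]; apply/andP; lia.
Qed.

(** The layers that meet the rectangle are those of index 1 up to the depth. *)
Lemma sum_has_layer a b :
  \sum_(j <- iota 1 (size S)) has (rect a b) (layer v S j) = depth v S a b.
Proof.
have le_dS : depth v S a b <= size S.
  by apply/bigmax_leqP_seq => x _ _; apply: rank_le_size.
have -> : \sum_(j <- iota 1 (size S)) has (rect a b) (layer v S j) =
          \sum_(j <- iota 1 (size S)) (j <= depth v S a b).
  by apply: eq_big_seq => j; rewrite mem_iota => /andP[j0 _]; rewrite has_rect_layer.
elim: (size S) (depth v S a b) le_dS => [|m IH] k le_km.
  by rewrite big_nil; lia.
rewrite -(addn1 m) iotaD big_cat /= big_seq1 add1n.
move: le_km; rewrite leq_eqVlt => /orP[/eqP ->|]; last first.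
  by rewrite ltnS => le_km; rewrite IH //; lia.
rewrite ltnS leqnn addn1; congr _.+1; rewrite -[RHS](IH m) //.
apply: eq_big_seq => j; rewrite mem_iota => ?; congr nat_of_bool; lia.
Qed.

End Chains.

(** * Inner and outer corners of a single layer *)

Definition inner_corners n (s : seq (cell n)) : seq (cell n) :=
  flatten [seq block_prime B | B <- blocks s].

(** Attach to a cell [(r, c)] of N^v the interval of all a with c < a <= r. Consecutive cells of an
    arranged layer are related exactly when their intervals overlap, so an outer corner encodes the
    union of the intervals of its block. *)
Definition outer_corners n (s : seq (cell n)) : seq (cell n) :=
  pmap (@block_w n) (blocks s).

Section Blocks.
Variable n : nat.
Implicit Types (x y : cell n) (s : seq (cell n)) (a b : nat).

Lemma cell_le_trans : transitive (@cell_le n).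
Proof. by move=> y x z /andP[? ?] /andP[? ?]; apply/andP; split; lia. Qed.

Lemma blocks_cons y s : exists B Bs, blocks (y :: s) = (y :: B) :: Bs.
Proof.
case E: (blocks s) => [|[|z B] Bs]; rewrite /= E.
- by exists [::], [::].
- by exists [::], [::].
by case: ifP => _; [exists (z :: B), Bs | exists [::], ((z :: B) :: Bs)].
Qed.

Lemma blocks_consE x y s :
  blocks (x :: y :: s) =
    if related x y then (x :: head [::] (blocks (y :: s))) :: behead (blocks (y :: s))
    else [:: x] :: blocks (y :: s).
Proof. by have [B [Bs E]] := blocks_cons y s; rewrite [LHS]/= -/(blocks (y :: s)) E. Qed.

Lemma inner_corners_cons x y s :
  inner_corners (x :: y :: s) =
    if related x y then (x.1, y.2) :: inner_corners (y :: s)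
    else inner_corners (y :: s).
Proof.
rewrite /inner_corners blocks_consE; have [B [Bs ->]] := blocks_cons y s.
by case: ifP.
Qed.

Lemma outer_corners_cons x y s :
  exists z t, outer_corners (y :: s) = z :: t /\
  outer_corners (x :: y :: s) =
    if related x y then (z.1, x.2) :: t else x :: z :: t.
Proof.
rewrite /outer_corners blocks_consE; have [B [Bs ->]] := blocks_cons y s.
exists ((last y B).1, y.2), (pmap (@block_w n) Bs); split=> //.
by case: ifP => //= _; case: x.
Qed.

Lemma outer_corners_head y s z t : sorted (@cell_le n) (y :: s) ->
  outer_corners (y :: s) = z :: t -> z.2 = y.2 /\ y.1 <= z.1.
Proof.
elim: s y z t => [|y' s IH] y z t /=; first by move=> _ [<- _].
case/andP=> /andP[le1 le2] srt.
have [z' [t' [E ->]]] := outer_corners_cons y y' s.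
have [_ lez'] := IH _ _ _ srt E.
by case: ifP => _ [<- _] //=; split=> //; apply: leq_trans le1 lez'.
Qed.

Lemma has_rect_head y s a b : sorted (@cell_le n) (y :: s) ->
  has (rect a b) (y :: s) -> y.2 < a.
Proof.
move=> srt /= /orP[/andP[]//|/hasP[z zs /andP[lta _]]].
have /allP/(_ z zs)/andP[_] := order_path_min cell_le_trans srt.
by move=> leyz; apply: leq_ltn_trans leyz lta.
Qed.

(** The cells of [s] in [rect a b] are consecutive: [column < a] cuts off an initial segment,
    [row >= b] a final one. The corner of two neighbours is in [rect a b] exactly when both are, and
    then they are related, because the row of the first is >= b >= a > the column of the second. So
    p >= 1 cells yield p - 1 corners. *)
Lemma mass_inner_corners s a b : a <= b -> sorted (@cell_le n) s ->
  mass s a b = mass (inner_corners s) a b + has (rect a b) s.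
Proof.
move=> le_ab; elim: s => [|x [|y s] IH] //.
  by rewrite /mass /= addn0 orbF.
case/andP=> /andP[le1 le2] srt.
rewrite inner_corners_cons -[mass (x :: _) a b]/(rect a b x + mass (y :: s) a b) IH //.
rewrite -[has _ (x :: _)]/(rect a b x || has (rect a b) (y :: s)).
have lty := has_rect_head srt.
have hasy : rect a b y -> has (rect a b) (y :: s) by move=> /= ->.
(* About [has] on the tail, only two facts matter: it forces [y.2 < a], and it follows from
   [rect a b y]. The rest is arithmetic. *)
move: (has _ _) (lty a b) hasy => h {}lty hasy.
case: ifP; rewrite /related => rel; rewrite /mass /=;
  move: hasy; rewrite /rect /=; case: h lty => lty; lia.
Qed.

(** In terms of intervals, distinct blocks have disjoint unions, so at most one outer corner is
    counted; and a point in the union of a block is in the interval of one of its cells. *)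
Lemma count_outer_corners s a : sorted (@cell_le n) s ->
  count (rect a a) (outer_corners s) = has (rect a a) s.
Proof.
elim: s => [|x [|y s] IH] //; first by rewrite /= addn0 orbF; case: x.
case/andP=> /andP[le1 le2] srt.
have [z [t [E ->]]] := outer_corners_cons x y s.
have [Ez lez] := outer_corners_head srt E.
rewrite -[has _ (x :: _)]/(rect a a x || has (rect a a) (y :: s)).
have := IH srt; rewrite E [count _ _]/=.
have := @has_rect_head _ _ a a srt.
move: (has _ _) => h lty; case: ifP; rewrite /related => rel /=;
  rewrite /rect /= Ez; case: h lty; lia.
Qed.

Lemma size_corners s : size s = size (inner_corners s) + size (outer_corners s).
Proof.
elim: s => [|x [|y s] IH] //; rewrite [LHS]/= -[(size s).+1]/(size (y :: s)) IH.
have [z [t [E ->]]] := outer_corners_cons x y s.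
by rewrite inner_corners_cons E; case: ifP => _ /=; lia.
Qed.

Lemma sub_inner_corners (v : {set 'I_n}) s :
  {subset s <= Nset v} -> {subset inner_corners s <= Nset v}.
Proof.
elim: s => [|x [|y s] IH] // sub; rewrite inner_corners_cons => z.
have {}IH : {subset inner_corners (y :: s) <= Nset v}.
  by apply: IH => t ts; apply: sub; rewrite inE ts orbT.
case: ifP => [rel|_]; last exact: IH.
rewrite in_cons => /orP[/eqP ->|/IH //].
have := sub x; have := sub y; rewrite !inE !eqxx orbT => /(_ isT) + /(_ isT).
by case/andP=> /andP[_ ->] _ /andP[/andP[-> _] _].
Qed.

Lemma sub_outer_corners (v : {set 'I_n}) s :
  {subset s <= Nset v} -> sorted (@cell_le n) s ->
  {subset outer_corners s <= Nset v}.
Proof.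
elim: s => [|x [|y s] IH] //.
move=> sub /andP[/andP[le1 le2] srt].
have {}IH : {subset outer_corners (y :: s) <= Nset v}.
  by apply: IH => // t ts; apply: sub; rewrite inE ts orbT.
have [z [t [E ->]]] := outer_corners_cons x y s.
have [Ez lez] := outer_corners_head srt E; rewrite E in IH.
have := sub x; rewrite !inE eqxx => /(_ isT) /andP[/andP[xv1 xv2] ltx].
have := IH z; rewrite !inE eqxx => /(_ isT) /andP[/andP[zv1 zv2] ltz] u.
case: ifP => rel; rewrite in_cons.
  case/orP=> [/eqP ->|ut]; last by apply: IH; rewrite inE ut orbT.
  by rewrite !inE /= zv1 xv2 (leq_ltn_trans le2) // -Ez.
by case/orP=> [/eqP ->|/IH //]; rewrite !inE xv1 xv2.
Qed.

Lemma count_flatten_map (T : Type) (I : Type) (p : pred T) (f : I -> seq T) (l : seq I) :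
  count p (flatten [seq f j | j <- l]) = \sum_(j <- l) count p (f j).
Proof. by elim: l => [|j l IH]; rewrite ?big_nil // big_cons -IH -count_cat. Qed.

End Blocks.

(** * The two components of pi, assembled from the layers *)

Section PiMap.
Variables (n : nat) (v : {set 'I_n}) (S : {mset cell n}).
Hypothesis SN : {subset S <= Nset v}.
Implicit Types (x y : cell n) (j a b : nat).

Definition all_outer_corners : seq (cell n) :=
  flatten [seq outer_corners (arranged v S j) | j <- iota 1 (size S)].

Lemma pi_map1E : (pi_map v S).1 = swap v all_outer_corners.
Proof.
rewrite /pi_map /= /all_blocks /all_outer_corners; congr swap.
by elim: (iota _ _) => //= j l <-; rewrite pmap_cat.
Qed.

Lemma pi_map2_perm : perm_eq (pi_map v S).2
  (flatten [seq inner_corners (arranged v S j) | j <- iota 1 (size S)]).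
Proof.
rewrite (permPl (perm_eq_seq_mset _)) /all_blocks.
suff -> : flatten [seq block_prime B | B <- flatten [seq blocks (arranged v S j)
  | j <- iota 1 (size S)]] =
  flatten [seq inner_corners (arranged v S j) | j <- iota 1 (size S)] by [].
by elim: (iota _ _) => //= j l <-; rewrite map_cat flatten_cat.
Qed.

Lemma mem_arranged j : arranged v S j =i layer v S j.
Proof. exact: mem_sort. Qed.

Lemma sub_arranged j : {subset arranged v S j <= S}.
Proof. by move=> x; rewrite mem_arranged mem_filter => /andP[]. Qed.

(** A cell greater than another has smaller rank, so the cells of one layer are pairwise
    incomparable for [cell_gt], which makes [cell_le] total on the layer. *)
Lemma sorted_arranged j : 0 < j -> sorted (@cell_le n) (arranged v S j).
Proof.
move=> j0; apply: (@sort_sorted_in _ (mem (layer v S j))); last exact/allP.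
move=> x y; rewrite /= !mem_layer // => /andP[/eqP Ex Sx] /andP[/eqP Ey Sy].
have rk z t : z \in S -> t \in S -> cell_gt z t -> rank v S z < rank v S t.
  by move=> Sz St zt; apply/(ltn_rankP SN _ St); right; exists z.
have := contraNN (rk _ _ Sx Sy); have := contraNN (rk _ _ Sy Sx).
rewrite Ex Ey ltnn => /(_ isT) + /(_ isT); rewrite /cell_gt /cell_le.
lia.
Qed.

(** Each cell of [S] lies in exactly one layer, the one indexed by its rank, and this rank is
    between 1 and [size S]. *)
Lemma count_layers (p : pred (cell n)) :
  count p S = \sum_(j <- iota 1 (size S)) count p (arranged v S j).
Proof.
have -> : \sum_(j <- iota 1 (size S)) count p (arranged v S j) =
  \sum_(j <- iota 1 (size S)) \sum_(x <- S) (p x && (rank v S x == j)).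
  apply: eq_big_seq => j; rewrite mem_iota => /andP[j0 _].
  rewrite /arranged count_sort count_filter -sum1_count big_mkcond /=.
  apply: eq_big_seq => x Sx; rewrite -!leq_rank //.
  by case: (p x) => //=; case: ifP; lia.
rewrite exchange_big /= -sum1_count big_mkcond /=; apply: eq_big_seq => x Sx.
case: (p x) => /=; last by rewrite big1.
rewrite -big_mkcond sum1_count (eq_count (a2 := pred1 (rank v S x))).
  by rewrite count_uniq_mem ?iota_uniq // mem_iota rank_gt0 // Sx add1n ltnS rank_le_size.
by move=> j; rewrite /= eq_sym.
Qed.

(** Passing to inner corners costs one cell in the rectangle for each layer that meets it, and the
    depth is the number of these layers. *)
Lemma mass_pi_map a b : a <= b ->
  mass S a b = mass (pi_map v S).2 a b + depth v S a b.
Proof.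
move=> le_ab; rewrite /mass (permP pi_map2_perm) count_flatten_map count_layers.
rewrite -(sum_has_layer SN) -big_split /=; apply: eq_big_seq => j.
rewrite mem_iota => /andP[j0 _].
rewrite -/(mass _ _ _) (mass_inner_corners le_ab) ?sorted_arranged //.
by rewrite (eq_has_r (mem_arranged j)).
Qed.

Lemma count_all_outer_corners a :
  count (rect a a) all_outer_corners = depth v S a a.
Proof.
rewrite count_flatten_map -(sum_has_layer SN); apply: eq_big_seq => j.
rewrite mem_iota => /andP[j0 _].
by rewrite count_outer_corners ?sorted_arranged // (eq_has_r (mem_arranged j)).
Qed.

Lemma size_pi_map : size S = size (pi_map v S).2 + size all_outer_corners.
Proof.
rewrite (perm_size pi_map2_perm) -[LHS]count_predT count_layers.
rewrite -[size (flatten _)]count_predT -[size all_outer_corners]count_predT.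
rewrite !count_flatten_map -big_split /=; apply: eq_bigr => j _.
by rewrite !count_predT -size_corners.
Qed.

Lemma sub_pi_map : {subset (pi_map v S).2 <= Nset v}.
Proof.
move=> x; rewrite (perm_mem pi_map2_perm) => /flatten_mapP[j _].
by apply: sub_inner_corners => y /sub_arranged; apply: SN.
Qed.

Lemma sub_all_outer_corners : {subset all_outer_corners <= Nset v}.
Proof.
move=> x /flatten_mapP[j]; rewrite mem_iota => /andP[j0 _].
apply: sub_outer_corners; last exact: sorted_arranged.
by move=> y /sub_arranged; apply: SN.
Qed.

End PiMap.

(** * Exchanging columns in [v] for rows outside [v] *)

Section Swap.
Variables (n : nat) (v : {set 'I_n}).
Implicit Types (s : seq (cell n)) (x : nat).

Lemma count_ltnS (T : Type) (f : T -> nat) (s : seq T) x :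
  count (fun b => f b < x.+1) s = count (fun b => f b < x) s + count (fun b => f b == x) s.
Proof. by elim: s => //= b s ->; lia. Qed.

Lemma mem_NsetP (b : cell n) :
  reflect [/\ b.1 \notin v, b.2 \in v & b.2 < b.1] (b \in Nset v).
Proof. by rewrite !inE -andbA; apply: and3P. Qed.

Lemma count_rect_diag s x : {subset s <= Nset v} ->
  count (fun b : cell n => b.2 < x) s = count (fun b : cell n => b.1 < x) s + count (rect x x) s.
Proof.
elim: s => //= b s IH sub; rewrite IH => [|y ys]; last by apply: sub; rewrite inE ys orbT.
have /mem_NsetP[_ _ lt_b] : b \in Nset v by apply: sub; rewrite inE eqxx.
by rewrite addnACA; congr (_ + _); rewrite /rect; lia.
Qed.

(** Replacing c by r lowers the number of elements below [x] exactly when c < x <= r. Distinct rows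
    and distinct columns ensure that no exchange is absorbed by another one. *)
Lemma cnt_swap s x : {subset s <= Nset v} ->
  uniq [seq b.1 | b <- s] -> uniq [seq b.2 | b <- s] -> x <= n ->
  cnt (swap v s) x + count (rect x x) s = cnt v x.
Proof.
move=> sub u1 u2 le_xn.
(* With rows and columns counted separately, passing from [x] to [x.+1] only concerns the index [x]
   itself, so induction applies. *)
suff : cnt (swap v s) x + count (fun b : cell n => b.2 < x) s =
       cnt v x + count (fun b : cell n => b.1 < x) s by rewrite count_rect_diag //; lia.
elim: x le_xn => [|x IH] lt_xn.
  by rewrite !cnt0; congr (_ + _); apply: eq_count.
rewrite !(cntSn _ lt_xn) (count_ltnS (fun b : cell n => b.1 : nat)).
rewrite (count_ltnS (fun b : cell n => b.2 : nat)).
rewrite addnACA IH ?(ltnW lt_xn) // [RHS]addnACA; congr (_ + _).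
set i := Ordinal lt_xn.
have -> : count (fun b : cell n => b.1 == x :> nat) s = (i \in [seq b.1 | b <- s]).
  by rewrite -count_uniq_mem // count_map; apply: eq_count.
have -> : count (fun b : cell n => b.2 == x :> nat) s = (i \in [seq b.2 | b <- s]).
  by rewrite -count_uniq_mem // count_map; apply: eq_count.
rewrite !inE; have [/mapP[b /sub]|_] := boolP (i \in [seq b.1 | b <- s]).
  rewrite !inE => /andP[/andP[/negPf bv _] _] Eb; rewrite Eb bv !orbT.
  case: mapP => // -[b' /sub]; rewrite !inE => /andP[/andP[_ bv'] _] Eb'.
  by rewrite -Eb' bv in bv'.
rewrite orbF addn0; case: mapP => [[b /sub]|_ /=]; last by rewrite addn0.
by rewrite !inE => /andP[/andP[_ bv] _] ->; rewrite bv.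
Qed.

Lemma card_swap s : {subset s <= Nset v} ->
  uniq [seq b.1 | b <- s] -> uniq [seq b.2 | b <- s] -> #|swap v s| = #|v|.
Proof.
move=> sub u1 u2; rewrite -!cnt_ord -(cnt_swap sub u1 u2 (leqnn n)).
rewrite (eq_count (a2 := pred0)) ?count_pred0 ?addn0 // => b.
by rewrite /rect; have := ltn_ord b.1; case: (b.1) => /= r _; lia.
Qed.

Lemma vdegree_swap s : {subset s <= Nset v} ->
  uniq [seq b.1 | b <- s] -> vdegree v (swap v s) = size s.
Proof.
move=> sub u1; rewrite /vdegree.
have -> : swap v s :\: v = [set:: [seq b.1 | b <- s]].
  apply/setP=> i; rewrite !inE; have [vi|nvi] /= := boolP (i \in v); last by rewrite andbF.
  apply/esym/mapP => -[b /sub]; rewrite !inE => /andP[/andP[/negPf bv _] _] Eb.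
  by rewrite Eb bv in vi.
rewrite -(size_map fst); have /card_uniqP <- := u1.
by apply: eq_card => i; rewrite inE.
Qed.

Lemma uniq_count_le1 (T : eqType) (t : seq T) :
  (forall z, count_mem z t <= 1) -> uniq t.
Proof.
move=> H; apply: count_mem_uniq => z; have := H z.
by rewrite -has_pred1 has_count; case: (count_mem z t) => [|[]].
Qed.

(* A unit step of the number of cells crossing the diagonal at [x] leaves room
   for one row or one column with index [x]; rows and columns cannot both
   contribute since rows avoid [v] and columns lie in [v]. *)
Lemma uniq_rows_cols s : {subset s <= Nset v} ->
  (forall x, x < n -> count (rect x x) s <= (count (rect x.+1 x.+1) s).+1 /\
                      count (rect x.+1 x.+1) s <= (count (rect x x) s).+1) ->
  uniq [seq b.1 | b <- s] /\ uniq [seq b.2 | b <- s].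
Proof.
move=> sub H.
suff Hi (i : 'I_n) : count_mem i [seq b.1 | b <- s] <= 1 /\ count_mem i [seq b.2 | b <- s] <= 1.
  by split; apply: uniq_count_le1 => i; case: (Hi i).
have := H i (ltn_ord i); have := count_rect_diag i sub; have := count_rect_diag i.+1 sub.
rewrite (count_ltnS (fun b : cell n => b.1 : nat)).
rewrite (count_ltnS (fun b : cell n => b.2 : nat)) !count_map.
rewrite -[count (preim _ _) _]/(count (fun b : cell n => b.1 == i :> nat) s).
rewrite -[count (preim snd _) _]/(count (fun b : cell n => b.2 == i :> nat) s).
have [vi|nvi] := boolP (i \in v).
  have -> : count (fun b : cell n => b.1 == i :> nat) s = 0; last by lia.
  apply/eqP; rewrite -leqn0 leqNgt -has_count; apply/hasPn => b /sub.
  by rewrite !inE => /andP[/andP[bv _] _]; apply: contra bv => /eqP/val_inj ->.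
have -> : count (fun b : cell n => b.2 == i :> nat) s = 0; last by lia.
apply/eqP; rewrite -leqn0 leqNgt -has_count; apply/hasPn => b /sub.
by rewrite !inE => /andP[/andP[_ bv] _]; apply: contraNN nvi => /eqP/val_inj <-.
Qed.

Lemma chain_uniq s : sorted (@cell_gt n) s ->
  uniq [seq b.1 | b <- s] /\ uniq [seq b.2 | b <- s].
Proof.
move=> srt.
have gt1 : {homo (fun b : cell n => val b.1) : b c / cell_gt b c >-> c < b} by move=> b c /andP[].
have gt2 : {homo (fun b : cell n => val b.2) : b c / cell_gt b c >-> b < c} by move=> b c /andP[].
split; apply: (@map_uniq _ _ val); rewrite -map_comp.
  rewrite -rev_uniq; apply: (sorted_uniq ltn_trans ltnn).
  by rewrite rev_sorted; exact: homo_sorted gt1 _ srt.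
apply: (sorted_uniq ltn_trans ltnn).
exact: homo_sorted gt2 _ srt.
Qed.

End Swap.

(** * Domination expressed by the depth on the diagonal *)

Section Domination.
Variables (n : nat) (v : {set 'I_n}) (S : {mset cell n}).
Hypothesis SN : {subset S <= Nset v}.

(** The values [depth x x] and [depth x.+1 x.+1] both exceed [depth x x.+1] by at most one, so the
    depth makes at most unit steps along the diagonal, as [uniq_rows_cols] requires. *)
Lemma uniq_all_outer_corners :
  uniq [seq b.1 | b <- all_outer_corners v S] /\
  uniq [seq b.2 | b <- all_outer_corners v S].
Proof.
apply: uniq_rows_cols (sub_all_outer_corners SN) _ => x lt_xn.
rewrite !count_all_outer_corners //.
have := depthSl SN x x; have := depthSr SN x.+1 x.
have := depthSl SN x x.+1; have := depthSr SN x x.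
lia.
Qed.

Lemma cnt_pi_map x : x <= n ->
  cnt (pi_map v S).1 x + depth v S x x = cnt v x.
Proof.
move=> le_xn; have [u1 u2] := uniq_all_outer_corners.
by rewrite pi_map1E -count_all_outer_corners // cnt_swap // => y; apply: sub_all_outer_corners.
Qed.

Lemma card_pi_map : #|(pi_map v S).1| = #|v|.
Proof.
have [u1 u2] := uniq_all_outer_corners; rewrite pi_map1E card_swap //.
exact: sub_all_outer_corners.
Qed.

Lemma size_pi_map_vdegree :
  size S = size (pi_map v S).2 + vdegree v (pi_map v S).1.
Proof.
have [u1 _] := uniq_all_outer_corners; rewrite (size_pi_map SN) pi_map1E.
by rewrite vdegree_swap //; apply: sub_all_outer_corners.
Qed.

Lemma leI_pi_map : leI v (pi_map v S).1.
Proof. by apply/leI_cntP; rewrite ?card_pi_map // => x /cnt_pi_map; lia. Qed.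

Lemma pi_map_neq : S != mset0 -> (pi_map v S).1 != v.
Proof.
move=> S0; have [b Sb] : exists b, b \in S.
  case E: (enum_mset S) => [|b s]; last first.
    by exists b; rewrite -[_ \in S]/(b \in enum_mset S) E inE eqxx.
  case/negP: S0; apply/mset_eqP => b; apply/eqP; rewrite mset0E mset_eq0.
  by rewrite -[_ \in S]/(b \in enum_mset S) E.
apply/eqP => Ev; have := @cnt_pi_map b.1 (ltnW (ltn_ord _)); rewrite Ev.
(* The cell [b] crosses the diagonal at its own row, so the counts of [v] and of the first component
   differ there. *)
have : 0 < depth v S b.1 b.1.
  apply/ltn_depthP; exists b; rewrite (rank_gt0 SN) Sb; split=> //.
  by have /mem_NsetP[_ _ ltb] := SN Sb; rewrite /rect ltb leqnn.
lia.
Qed.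

(** Swapping a chain lowers the count at [x] by the number of its cells in [rect x x]. These form a
    chain, so there are at most [depth v S x x] of them. Conversely, if the last cell of a chain is
    in [rect x x], so are all the greater ones, and the bound is attained. *)
Lemma dominatesP (w : {set 'I_n}) : #|w| = #|v| ->
  dominates v w S <-> forall x, x <= n -> depth v S x x + cnt w x <= cnt v x.
Proof.
move=> eq_wv; split=> [dom x le_xn|dom s /andP[/allP sN srt] sS]; last first.
  have [u1 u2] := chain_uniq srt.
  apply/leI_cntP=> [|x le_xn]; first by rewrite card_swap.
  have := cnt_swap sN u1 u2 le_xn; have := dom x le_xn.
  suff : count (rect x x) s <= depth v S x x by lia.
  rewrite -size_filter; have: sorted (@cell_gt n) (filter (rect x x) s).
    exact: sorted_filter (@cell_gt_trans n) _ _ srt.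
  have: {subset filter (rect x x) s <= S}.
    by move=> b; rewrite mem_filter => /andP[_ /sS].
  have: all (rect x x) (filter (rect x x) s) by apply: filter_all.
  case/lastP: (filter _ _) => // t b; rewrite all_rcons size_rcons => /andP[rb _] sub st.
  apply/ltn_depthP; exists b; split=> //.
    by apply: sub; rewrite mem_rcons inE eqxx.
  by rewrite leq_rank //; apply/ends_chain_rcons => //; exists t.
(* At depth 0 the empty chain supplies the inequality between [v] and [w]. *)
case E: (depth v S x x) => [|k].
  have /leIP[_] : leI (swap v [::]) w by apply: dom.
  rewrite (_ : swap v [::] = v) => [/(_ x)//|].
  by apply/setP=> i; rewrite !inE orbF.
have /ltn_depthP[b [Sb rb]] : k < depth v S x x by rewrite E.
rewrite leq_rank // => /(ends_chain_rcons SN)[s [sz srt sub]].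
have sN : {subset rcons s b <= Nset v} by move=> y /sub /SN.
have [u1 u2] := chain_uniq srt.
have /leIP[_ /(_ x)] : leI (swap v (rcons s b)) w.
  by apply: dom => //; apply/andP; split=> //; apply/allP.
have := cnt_swap sN u1 u2 le_xn.
suff -> : count (rect x x) (rcons s b) = k.+1 by lia.
rewrite -sz -(size_rcons s b); apply/eqP; rewrite -all_count all_rcons rb /=.
move: srt; rewrite (sorted_pairwise (@cell_gt_trans n)) pairwise_rcons => /andP[/allP gtb _].
apply/allP => y /gtb; move: rb; rewrite /rect /cell_gt => /andP[? ?] /andP[? ?].
by apply/andP; lia.
Qed.

Lemma mass_diff (r c : 'I_n) :
  mass S c.+1 r.+1 + mass S c r + S (r, c) = mass S c.+1 r + mass S c r.+1.
Proof.
rewrite -count_mem_mset /mass; elim: (enum_mset S) => //= b s IH.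
have : (b == (r, c)) = (b.1 == r :> nat) && (b.2 == c :> nat) by case: b.
by move: IH; rewrite /rect => ? ->; lia.
Qed.

End Domination.

(** * The local rule of the growth diagram and injectivity of pi *)

Section Growth.
Variables (n : nat) (v : {set 'I_n}) (S : {mset cell n}).
Hypothesis SN : {subset S <= Nset v}.
Local Notation S' := (pi_map v S).2.

Lemma pi_map_count (r c : 'I_n) : c < r ->
  S (r, c) + depth v S c.+1 r.+1 + depth v S c r =
  S' (r, c) + depth v S c.+1 r + depth v S c r.+1.
Proof.
move=> lt_cr; have := mass_diff S r c; have := mass_diff S' r c.
have M a b := @mass_pi_map _ _ _ SN a b.
rewrite (M c.+1 r.+1) ?(M c r) ?(M c.+1 r) ?(M c r.+1); lia.
Qed.

(* The local rule read backwards. *)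
Lemma depth_pi_map (r c : 'I_n) : c < r ->
  depth v S c r.+1 =
  minn (depth v S c.+1 r.+1) (depth v S c r) -
  [&& depth v S c.+1 r == depth v S c.+1 r.+1,
      depth v S c.+1 r == depth v S c r & 0 < S' (r, c)].
Proof.
move=> lt_cr; have := pi_map_count lt_cr; have := depth_rec SN r c.
have := depthSl SN c r; have := depthSl SN c r.+1.
have := depthSr SN c r; have := depthSr SN c.+1 r.
rewrite in_mset; move: (S _) (S' _) => k k'; case: ifP; lia.
Qed.

(** Induction from the outer boundary of the staircase towards the diagonal: the three neighbours
    used have smaller [a + (n - b)]. *)
Lemma grid_ind (P : nat -> nat -> Prop) :
  (forall b, P 0 b) -> (forall a b, a <= b -> n <= b -> P a b) ->
  (forall r c : 'I_n, c < r -> P c.+1 r.+1 -> P c r -> P c r.+1 -> P c.+1 r) ->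
  forall a b, a <= b -> P a b.
Proof.
move=> P0 Pn PS a b; have [k] := ubnP (a + (n - b)).
elim: k a b => // k IH [|c] r ltk lt_cr; first exact: P0.
have [/(Pn _ _ lt_cr)//|lt_rn] := leqP n r.
by apply: (PS (Ordinal lt_rn) (Ordinal (ltn_trans lt_cr lt_rn))) => //=; apply: IH; lia.
Qed.

(** A cell of [S'] at [(r, c)] forces lam < rho: if lam = rho, then mu and nu equal them too, so k =
    k', and k > 0 would give rho > lam. With this the forward rule for [S'] stays below the one for
    [S]. On the diagonal this makes the sequence of first components weakly decreasing. *)
Lemma depth_pi_map_le a b : a <= b -> depth v S' a b <= depth v S a b.
Proof.
have S'N := sub_pi_map SN.
move: a b; apply: (grid_ind (P := fun a b => depth v S' a b <= depth v S a b))
  => [b|a b _ le_nb|r c lt_cr]; [by rewrite depth0 | by rewrite depthn |].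
rewrite (depth_rec S'N r c) (depth_rec SN r c).
have := pi_map_count lt_cr; have := depth_rec SN r c.
have := depthSl SN c r; have := depthSl SN c r.+1.
have := depthSr SN c r; have := depthSr SN c.+1 r.
rewrite !in_mset; move: (S _) (S' _) => k k'.
by do 2!case: ifP; lia.
Qed.

End Growth.

Lemma eq_mset_Nset n (v : {set 'I_n}) (S T : {mset cell n}) :
  {subset S <= Nset v} -> {subset T <= Nset v} ->
  (forall r c : 'I_n, c < r -> S (r, c) = T (r, c)) -> S = T.
Proof.
move=> SN TN H; apply/msetP => -[r c].
have [|le_rc] := ltnP c r; first exact: H.
have out (U : {mset cell n}) : {subset U <= Nset v} -> U (r, c) = 0.
  move=> UN; apply/mset_eq0P; apply/negP => /UN/mem_NsetP[_ _] /=; lia.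
by rewrite !out.
Qed.

Lemma pi_map_inj n (v : {set 'I_n}) (S T : {mset cell n}) :
  {subset S <= Nset v} -> {subset T <= Nset v} -> pi_map v S = pi_map v T -> S = T.
Proof.
move=> SN TN eqST.
have diag x : x <= n -> depth v S x x = depth v T x x.
  by move=> le_xn; have := cnt_pi_map SN le_xn; have := cnt_pi_map TN le_xn; rewrite eqST; lia.
(* Induction on the distance to the diagonal. Distance 1 is settled by [depth_off], since the local
   rule only yields distances of at least 2. *)
have eq_depth a b : a <= b <= n -> depth v S a b = depth v T a b.
  have [k] := ubnP (b - a); elim: k a b => // k IH a b ltk /andP[le_ab le_bn].
  have [Eb|lt_ab] := eqVneq a b; first by rewrite -Eb diag // Eb.
  case: b lt_ab le_bn le_ab ltk => [|r] ne_ar lt_rn le_ar ltk; first lia.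
  have [Er|ne_ar'] := eqVneq a r; first by rewrite Er !depth_off // !diag // ltnW.
  have lt_ar : a < r by lia.
  have := @depth_pi_map _ _ _ SN (Ordinal lt_rn) (Ordinal (ltn_trans lt_ar lt_rn)) lt_ar.
  have := @depth_pi_map _ _ _ TN (Ordinal lt_rn) (Ordinal (ltn_trans lt_ar lt_rn)) lt_ar.
  rewrite eqST /= => -> ->.
  by rewrite (IH a.+1 r.+1) ?(IH a r) ?(IH a.+1 r) //; lia.
apply: (eq_mset_Nset SN TN) => r c lt_cr.
have lt_rn := ltn_ord r; have := pi_map_count SN lt_cr; have := pi_map_count TN lt_cr.
by rewrite eqST !eq_depth; lia.
Qed.

(** * Reconstruction of a growth diagram from its diagonal *)

Section ReverseGrowth.
Variables (n : nat) (h : nat -> nat) (k' D : nat -> nat -> nat).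

(** Here [t] is the distance b - a to the diagonal. Distance 1 copies [depth_off]; larger distances
    copy [depth_pi_map] and refer to distances t - 1 and t - 2, with [a + t''.+1] the row b - 1 of
    the cell concerned. *)
Fixpoint grid_rec (t a : nat) : nat :=
  match t with
  | 0 => h a
  | t'.+1 =>
    match t' with
    | 0 => minn (h a) (h a.+1)
    | t''.+1 => minn (grid_rec t' a.+1) (grid_rec t' a) -
        [&& grid_rec t'' a.+1 == grid_rec t' a.+1,
            grid_rec t'' a.+1 == grid_rec t' a & 0 < k' (a + t''.+1) a]
    end
  end.

Definition grid (a b : nat) : nat := grid_rec (b - a) a.

Lemma grid_diag x : grid x x = h x.
Proof. by rewrite /grid subnn. Qed.

Lemma grid_off x : grid x x.+1 = minn (h x) (h x.+1).
Proof. by rewrite /grid subSnn. Qed.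

Lemma grid_rev r c : c < r ->
  grid c r.+1 = minn (grid c.+1 r.+1) (grid c r) -
    [&& grid c.+1 r == grid c.+1 r.+1, grid c.+1 r == grid c r & 0 < k' r c].
Proof.
move=> lt_cr; rewrite /grid; have -> : r.+1 - c = (r - c.+1).+2 by lia.
have -> : r.+1 - c.+1 = (r - c.+1).+1 by lia.
have -> : r - c = (r - c.+1).+1 by lia.
by rewrite /= (_ : c + (r - c.+1).+1 = r) //; lia.
Qed.

Hypothesis h0 : h 0 = 0.
Hypothesis hn : h n = 0.
Hypothesis h_lip : forall x, x < n -> h x.+1 <= (h x).+1 /\ h x <= (h x.+1).+1.
Hypothesis D_le : forall x, x <= n -> D x x <= h x.
Hypothesis DSl : forall a b, D a b <= D a.+1 b.
Hypothesis DSr : forall a b, D a b.+1 <= D a b.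
Hypothesis D_lt : forall r c, c < r < n -> 0 < k' r c -> D c r.+1 < D c.+1 r.

(** By induction mu and nu are rho or rho - 1. If they differ, lam is the smaller one; if they
    agree, lam is their common value, or one less when the correction applies. *)
Lemma grid_steps a b : a <= b < n ->
  grid a b.+1 <= grid a b <= (grid a b.+1).+1 /\
  grid a b.+1 <= grid a.+1 b.+1 <= (grid a b.+1).+1.
Proof.
have [m] := ubnP (b - a); elim: m a b => // m IH a b ltm /andP[le_ab lt_bn].
have [Eb|ne_ab] := eqVneq a b.
  by rewrite -Eb !grid_diag grid_off; have [] := @h_lip b lt_bn; rewrite -Eb; lia.
case: b ne_ab le_ab lt_bn ltm => [|b] ne_ab le_ab lt_bn ltm; first lia.
have lt_ab : a < b.+1 by lia.
rewrite (grid_rev lt_ab).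
have le_ab' : a <= b < n by lia.
have ltm' : b - a < m by lia.
have [_] := IH a b ltm' le_ab'.
have le_ab'' : a.+1 <= b.+1 < n by lia.
have ltm'' : b.+1 - a.+1 < m by lia.
have [+ _] := IH a.+1 b.+1 ltm'' le_ab''.
lia.
Qed.

(** [D] stands for the depth of the prescribed second component, and [D_le] for its domination.
    Where the rule subtracts one, [D_lt] makes [D c r.+1] strictly smaller than [D c.+1 r], so the
    lower bound survives. *)
Lemma grid_ge a b : a <= b <= n -> D a b <= grid a b.
Proof.
have [m] := ubnP (b - a); elim: m a b => // m IH a b ltm /andP[le_ab le_bn].
have [Eb|ne_ab] := eqVneq a b; first by rewrite Eb grid_diag D_le.
case: b ne_ab le_ab le_bn ltm => [|b] ne_ab le_ab le_bn ltm; first lia.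
have [Eb|ne_ab'] := eqVneq a b.
  rewrite Eb grid_off leq_min (leq_trans (DSr _ _) (D_le (ltnW le_bn))).
  by rewrite (leq_trans (DSl _ _) (D_le le_bn)).
have lt_ab : a < b by lia.
rewrite (grid_rev lt_ab).
have mu : D a.+1 b.+1 <= grid a.+1 b.+1 by apply: IH; lia.
have nu : D a b <= grid a b by apply: IH; lia.
have rho : D a.+1 b <= grid a.+1 b by apply: IH; lia.
have := DSl a b.+1; have := DSr a b; have := @D_lt b a.
lia.
Qed.

Lemma grid_monol a b c : a <= c <= b -> b <= n -> grid a b <= grid c b.
Proof.
case/andP=> /subnK <-; elim: (c - a) => // k IH le_cb le_bn; rewrite addSn.
apply: leq_trans (IH _ _) _; [lia|lia|].
have [|_] := @grid_steps (k + a) b.-1; first lia.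
by rewrite prednK; lia.
Qed.

Lemma grid_monor a b c : a <= b <= c -> c <= n -> grid a c <= grid a b.
Proof.
case/andP=> le_ab /subnK <-; elim: (c - b) => // k IH le_bn.
have [|+ _] := @grid_steps a (k + b); [lia | rewrite addSn; have := IH; lia].
Qed.

Lemma grid0 b : b <= n -> grid 0 b = 0.
Proof.
by move=> le_bn; have := @grid_monor 0 0 b; rewrite grid_diag h0; lia.
Qed.

Lemma gridn a : a <= n -> grid a n = 0.
Proof.
by move=> le_an; have := @grid_monol a n n; rewrite grid_diag hn; lia.
Qed.

(* Truncated subtraction is exact here, see [grid_multE]. *)
Definition grid_mult (r c : nat) : nat :=
  k' r c + grid c.+1 r + grid c r.+1 - grid c.+1 r.+1 - grid c r.

(** The value lam is the minimum of mu and nu and rho is at least their maximum, except where one is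
    subtracted from lam; there [k' > 0] makes up for it. *)
Lemma grid_multE r c : c < r < n ->
  grid_mult r c + grid c.+1 r.+1 + grid c r =
  k' r c + grid c.+1 r + grid c r.+1.
Proof.
case/andP=> lt_cr lt_rn; rewrite /grid_mult (grid_rev lt_cr).
(* The shift to [r.-1] makes the second half of [grid_steps] compare [grid c r] with
   [grid c.+1 r]. *)
have [|_] := @grid_steps c r.-1; first lia.
rewrite prednK; last lia.
have [|+ _] := @grid_steps c.+1 r; first lia.
have := @grid_ge c.+1 r; have := @D_lt r c.
lia.
Qed.

(** The delicate case is mu = nu = rho with [k' > 0]: [D_lt] and [grid_ge] give rho > 0, so the
    subtraction is not truncated and lam + 1 = rho, as the forward rule demands. *)
Lemma grid_rec_fwd r c : c < r < n ->
  grid c.+1 r = maxn (maxn (grid c.+1 r.+1) (grid c r))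
                     (if 0 < grid_mult r c then (grid c r.+1).+1 else 0).
Proof.
move=> ltcrn; have := grid_multE ltcrn; case/andP: ltcrn => lt_cr lt_rn.
rewrite (grid_rev lt_cr).
have [|_] := @grid_steps c r.-1; first lia.
rewrite prednK; last lia.
have [|+ _] := @grid_steps c.+1 r; first lia.
have := @grid_ge c.+1 r; have := @D_lt r c.
by case: ifP; lia.
Qed.

(** Applied to columns outside [v], where [h] cannot increase. The columns [c] and [c.+1] of the
    grid then coincide beyond the diagonal, and the alternating sum vanishes. [grid_row0] is the
    counterpart for rows in [v]. *)
Lemma grid_col0 c : c < n -> h c.+1 <= h c -> (forall r, c < r -> k' r c = 0) ->
  forall r, c < r < n -> grid_mult r c = 0.
Proof.
move=> lt_cn le_h k0.
have eq_col b : c < b <= n -> grid c b = grid c.+1 b.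
  elim: b => // b IH /andP[le_cb lt_bn]; have [Eb|ne_cb] := eqVneq c b.
    by rewrite -Eb grid_off grid_diag; lia.
  have lt_cb : c < b by lia.
  rewrite (grid_rev lt_cb) k0 // !andbF IH; last lia.
  have [|+ _] := @grid_steps c.+1 b; lia.
move=> r /andP[lt_cr lt_rn]; rewrite /grid_mult k0 // !eq_col; lia.
Qed.

Lemma grid_row0 r : r < n -> h r <= h r.+1 -> (forall c, c < r -> k' r c = 0) ->
  forall c, c < r -> grid_mult r c = 0.
Proof.
move=> lt_rn le_h k0.
have eq_row a : a <= r -> grid a r = grid a r.+1.
  move=> le_ar; have [m] := ubnP (r - a); elim: m a le_ar => // m IH a le_ar ltm.
  have [Ea|ne_ar] := eqVneq a r; first by rewrite Ea grid_off grid_diag; lia.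
  have lt_ar : a < r by lia.
  rewrite (grid_rev lt_ar) k0 // !andbF -IH; [|lia|lia].
  have [|_] := @grid_steps a r.-1; first lia.
  rewrite prednK; lia.
move=> c lt_cr; rewrite /grid_mult k0 // -!eq_row; lia.
Qed.

End ReverseGrowth.

(** * Surjectivity of pi *)

Definition mset_of (T : finType) (f : T -> nat) : {mset T} :=
  seq_mset (flatten [seq nseq (f b) b | b <- enum T]).

Lemma mset_ofE (T : finType) (f : T -> nat) b : mset_of f b = f b.
Proof.
rewrite mset_seqE count_flatten -map_comp sumnE big_map big_enum /=.
rewrite (bigD1 b) //= count_nseq /= eqxx mul1n big1 ?addn0 // => c /negPf ne_cb.
by rewrite count_nseq /= ne_cb.
Qed.

Lemma pi_map_surj n (v u : {set 'I_n}) (T : {mset cell n}) :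
  {subset T <= Nset v} -> leI v u -> u != v ->
  (forall x, x <= n -> depth v T x x + cnt u x <= cnt v x) ->
  exists S : {mset cell n}, [/\ {subset S <= Nset v}, S != mset0 & pi_map v S = (u, T)].
Proof.
move=> TN le_vu ne_uv dom.
(* The diagonal that [cnt_pi_map] imposes on any preimage of [u]. *)
pose h x := cnt v x - cnt u x.
(* Indexed by arbitrary naturals, as the grid recursion requires; it agrees with [T] on actual
   cells. *)
pose k' r c := count (fun b : cell n => (b.1 == r :> nat) && (b.2 == c :> nat)) T.
have /leIP[card_vu le_cnt] := le_vu.
have k'E (r c : 'I_n) : k' r c = T (r, c) by rewrite -count_mem_mset; apply: eq_count => -[].
have h0 : h 0 = 0 by rewrite /h !cnt0.
have hn : h n = 0 by rewrite /h !cnt_ord card_vu subnn.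
have h_lip x : x < n -> h x.+1 <= (h x).+1 /\ h x <= (h x.+1).+1.
  by move=> lt_xn; rewrite /h !(cntSn _ lt_xn); lia.
have D_le x : x <= n -> depth v T x x <= h x by move=> /dom; rewrite /h; lia.
have DSl a b : depth v T a b <= depth v T a.+1 b by have /andP[] := depthSl TN a b.
have DSr a b : depth v T a b.+1 <= depth v T a b by have /andP[] := depthSr TN a b.
have D_lt r c : c < r < n -> 0 < k' r c -> depth v T c r.+1 < depth v T c.+1 r.
  case/andP=> lt_cr lt_rn k0; have lt_cn := ltn_trans lt_cr lt_rn.
  have := depth_rec TN (Ordinal lt_rn) (Ordinal lt_cn).
  by rewrite in_mset -k'E /= k0; lia.
pose k := grid_mult h k'.
pose S := mset_of (fun b : cell n => if b.2 < b.1 then k b.1 b.2 else 0).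
have SE (r c : 'I_n) : c < r -> S (r, c) = k r c by rewrite mset_ofE /= => ->.
have SN : {subset S <= Nset v}.
  move=> -[r c]; rewrite in_mset mset_ofE /=; case: ifP => // lt_cr k0.
  have lt_rn := ltn_ord r; have lt_cn := ltn_ord c.
  apply/mem_NsetP; split=> //=.
    apply: contraL k0 => rv; rewrite -leqNgt leqn0; apply/eqP.
    apply: (grid_row0 h0 hn h_lip lt_rn) => //.
      by rewrite /h !cntS rv; have := le_cnt r; lia.
    move=> c' lt_c'r; rewrite (k'E r (Ordinal (ltn_trans lt_c'r lt_rn))).
    by apply/mset_eq0P; apply/negP => /TN/mem_NsetP[/negP].
  apply: contraLR k0 => cv; rewrite -leqNgt leqn0; apply/eqP.
  apply: (grid_col0 h0 hn h_lip lt_cn); last by rewrite lt_cr.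
    by rewrite /h !cntS (negPf cv); lia.
  move=> r' lt_cr'; apply/eqP; rewrite -leqn0 leqNgt -has_count; apply/hasPn => b bT.
  apply/negP => /andP[_ /eqP/val_inj Eb]; case/TN/mem_NsetP: bT => _.
  by rewrite Eb (negPf cv).
(* Both sides vanish on the outer boundary and obey the same forward rule. *)
have depthE a b : a <= b <= n -> depth v S a b = grid h k' a b.
  case/andP=> le_ab; move: a b le_ab.
  apply: (grid_ind (n := n) (P := fun a b => b <= n -> depth v S a b = grid h k' a b)).
  - by move=> b le_bn; rewrite depth0 (grid0 k' h0 hn h_lip).
  - move=> a b le_ab le_nb le_bn; rewrite depthn //.
    have Eb : b = n by lia.
    by rewrite Eb (gridn k' h0 hn h_lip) // -Eb.
  move=> r c lt_cr + + + le_rn; have lt_rn := ltn_ord r.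
  rewrite (depth_rec SN r c) => -> // -> // -> //.
  have lt_crn : c < r < n by rewrite lt_cr.
  rewrite (grid_rec_fwd h0 hn h_lip D_le DSl DSr D_lt lt_crn).
  by rewrite in_mset SE.
exists S; split=> //.
  apply: contraNneq ne_uv => S0; apply/eqP/cnt_inj => x le_xn.
  have := depthE x x; rewrite leqnn le_xn grid_diag => /(_ isT).
  rewrite /depth S0 enum_mset0 big_nil /h; have := le_cnt x; lia.
have Eu : (pi_map v S).1 = u.
  apply: cnt_inj => x le_xn; have := cnt_pi_map SN le_xn.
  by rewrite depthE ?leqnn // grid_diag /h; have := le_cnt x; lia.
rewrite [LHS]surjective_pairing Eu; congr pair.
apply: (eq_mset_Nset (sub_pi_map SN) TN) => r c lt_cr; have lt_rn := ltn_ord r.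
have lt_crn : c < r < n by rewrite lt_cr.
have := pi_map_count SN lt_cr; rewrite SE // !depthE; [|lia..].
have := grid_multE h0 hn h_lip D_le DSl DSr D_lt lt_crn.
by rewrite -/k k'E; lia.
Qed.

(** * Iteration of pi *)

Section PiTilde.
Variables (n : nat) (v : {set 'I_n}).
Implicit Types (S T : {mset cell n}).

Definition above (u : {set 'I_n}) : bool := leI v u && (u != v).

Lemma pi_map_above S : {subset S <= Nset v} -> S != mset0 -> above (pi_map v S).1.
Proof. by move=> SN S0; rewrite /above leI_pi_map ?pi_map_neq. Qed.

Lemma vdegree_above u : above u -> 0 < vdegree v u.
Proof.
by case/andP=> /leI_card eq_vu ne_uv; rewrite lt0n vdegree_eq0.
Qed.

Lemma size_pi_map_lt S : {subset S <= Nset v} -> S != mset0 ->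
  size (pi_map v S).2 < size S.
Proof.
move=> SN S0; rewrite (size_pi_map_vdegree SN).
by have := vdegree_above (pi_map_above SN S0); lia.
Qed.

Lemma size_mset0 : size (mset0 : {mset cell n}) = 0.
Proof. by rewrite enum_mset0. Qed.

Lemma pi_tilde0 : pi_tilde v mset0 = [::].
Proof. by rewrite /pi_tilde size_mset0. Qed.

(** Every call strictly decreases the size, so the empty monomial is reached before the fuel runs
    out. *)
Lemma pi_tilde_rec_fuel S k l : {subset S <= Nset v} -> size S <= k -> size S <= l ->
  pi_tilde_rec k v S = pi_tilde_rec l v S.
Proof.
elim: k l S => [|k IH] l S SN.
  rewrite leqn0 => /eqP S0 _; have -> : S = mset0.
    apply/msetP => b; rewrite mset0E -count_mem_mset.
    by case: (enum_mset S) S0.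
  by case: l => //= l; rewrite eqxx.
case: l => [|l] leSk leSl.
  have -> : S = mset0; last by rewrite /= eqxx.
  apply/msetP => b; rewrite mset0E -count_mem_mset.
  by case: (enum_mset S) leSl.
rewrite /=; case: eqVneq => // S0; congr cons.
have lt := size_pi_map_lt SN S0; apply: IH; [exact: sub_pi_map| |].
  exact: leq_trans lt leSk.
exact: leq_trans lt leSl.
Qed.

Lemma pi_tilde_cons S : {subset S <= Nset v} -> S != mset0 ->
  pi_tilde v S = (pi_map v S).1 :: pi_tilde v (pi_map v S).2.
Proof.
move=> SN S0; have lt := size_pi_map_lt SN S0.
rewrite {1}/pi_tilde -(ltn_predK lt) /= (negPf S0); congr cons.
apply: pi_tilde_rec_fuel; [exact: sub_pi_map| |exact: leqnn].
by rewrite -ltnS (ltn_predK lt).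
Qed.

Lemma mset_size_ind (P : {mset cell n} -> Prop) :
  P mset0 ->
  (forall S, {subset S <= Nset v} -> S != mset0 -> P (pi_map v S).2 -> P S) ->
  forall S, {subset S <= Nset v} -> P S.
Proof.
move=> P0 PS S; have [k] := ubnP (size S); elim: k S => // k IH S ltk SN.
have [->//|S0] := eqVneq S mset0; apply: PS => //; apply: IH; last exact: sub_pi_map.
by have := size_pi_map_lt SN S0; lia.
Qed.

Lemma all_above_pi_tilde S : {subset S <= Nset v} -> all above (pi_tilde v S).
Proof.
move: S; apply: mset_size_ind => [|S SN S0 IH]; first by rewrite pi_tilde0.
by rewrite pi_tilde_cons //= IH pi_map_above.
Qed.

Lemma sum_vdegree_pi_tilde S : {subset S <= Nset v} ->
  \sum_(u <- pi_tilde v S) vdegree v u = size S.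
Proof.
move: S; apply: mset_size_ind => [|S SN S0 IH].
  by rewrite pi_tilde0 big_nil size_mset0.
by rewrite pi_tilde_cons // big_cons IH (size_pi_map_vdegree SN) addnC.
Qed.

(** Only the comparison of [w] with the first term matters: that term dominates the second
    component, whose depth is no larger ([depth_pi_map_le]), so by induction the rest of the path is
    automatic. [cnt_pi_map] translates the comparison into depths. *)
Lemma path_pi_tilde S : {subset S <= Nset v} -> forall w, leI v w ->
  path (@geI n) w (pi_tilde v S) <->
  (forall x, x <= n -> depth v S x x + cnt w x <= cnt v x).
Proof.
move: S; apply: mset_size_ind => [|S SN S0 IH] w le_vw.
  rewrite pi_tilde0; split=> // _ x le_xn; have /leIP[_ /(_ x)] := le_vw.
  by rewrite /depth enum_mset0 big_nil.
have le_vu := leI_pi_map SN.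
have -> : path (@geI n) w (pi_tilde v S) = leI (pi_map v S).1 w.
  rewrite pi_tilde_cons //= andb_idr // => _; apply/(IH _ le_vu) => x le_xn.
  by have := cnt_pi_map SN le_xn; have := depth_pi_map_le SN (leqnn x); lia.
have eqc : #|(pi_map v S).1| = #|w| by rewrite -(leI_card le_vu) (leI_card le_vw).
split=> [/(leI_cntP eqc) H x le_xn|H].
  by have := cnt_pi_map SN le_xn; have := H x le_xn; lia.
by apply/(leI_cntP eqc) => x le_xn; have := cnt_pi_map SN le_xn; have := H x le_xn; lia.
Qed.

Lemma sorted_pi_tilde S : {subset S <= Nset v} -> sorted (@geI n) (pi_tilde v S).
Proof.
move=> SN; have [->|S0] := eqVneq S mset0; first by rewrite pi_tilde0.
suff : path (@geI n) (pi_map v S).1 (pi_tilde v S) by apply: path_sorted.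
apply/(path_pi_tilde SN (leI_pi_map SN)) => x le_xn.
by rewrite addnC cnt_pi_map.
Qed.

Lemma pi_tilde_inj S T : {subset S <= Nset v} -> {subset T <= Nset v} ->
  pi_tilde v S = pi_tilde v T -> S = T.
Proof.
move=> SN; move: S SN T; apply: mset_size_ind => [|S SN S0 IH] T TN.
  rewrite pi_tilde0; have [->//|T0] := eqVneq T mset0.
  by rewrite pi_tilde_cons.
rewrite pi_tilde_cons //; have [->|T0] := eqVneq T mset0; first by rewrite pi_tilde0.
rewrite (pi_tilde_cons TN T0) => /eqP; rewrite eqseq_cons.
case/andP=> /eqP E1 /eqP/(IH _ (sub_pi_map TN)) E2.
by apply: (pi_map_inj SN TN); rewrite [LHS]surjective_pairing E1 E2 -surjective_pairing.
Qed.

(** The preimage is built from the tail. That [u] may precede the tail is, by [path_pi_tilde],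
    exactly the domination hypothesis of [pi_map_surj]. *)
Lemma pi_tilde_surj s : sorted (@geI n) s -> all above s ->
  exists2 S : {mset cell n}, {subset S <= Nset v} & pi_tilde v S = s.
Proof.
elim: s => [|u s IH] /= srt.
  by exists mset0; rewrite ?pi_tilde0 // => b; rewrite in_mset0.
case/andP=> /andP[le_vu ne_uv] /(IH (path_sorted srt))[T TN ET].
rewrite -ET in srt; have /(path_pi_tilde TN le_vu) dom := srt.
have [S [SN S0 ES]] := pi_map_surj TN le_vu ne_uv dom.
by exists S => //; rewrite pi_tilde_cons // ES /= ET.
Qed.

End PiTilde.

(** * The parts of a monomial inside and outside N^v *)

Definition star_cell n (b : cell n) : cell n := (rev_ord b.1, rev_ord b.2).

Lemma star_cellK n : involutive (@star_cell n).
Proof. by case=> r c; rewrite /star_cell !rev_ordK. Qed.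

Section Parts.
Variables (n : nat) (v : {set 'I_n}).
Implicit Types (S : {mset cell n}) (b : cell n).

Lemma star_monE S b : star_mon S b = S (star_cell b).
Proof.
rewrite mset_seqE count_map -count_mem_mset; apply: eq_count => c /=.
by rewrite -[RHS](inj_eq (can_inj (@star_cellK n))) star_cellK.
Qed.

Lemma seq_mset_filterE S (p : pred (cell n)) b :
  seq_mset [seq c <- S | p c] b = if p b then S b else 0.
Proof.
rewrite mset_seqE count_filter -count_mem_mset; case: ifP => pb.
  by apply: eq_count => c /=; case: eqVneq => // ->.
rewrite (eq_count (a2 := pred0)) ?count_pred0 // => c /=.
by case: eqVneq => // ->.
Qed.

Lemma pos_partE S b : pos_part v S b = if b \in Nset v then S b else 0.
Proof. exact: seq_mset_filterE. Qed.

Lemma neg_partE S b : neg_part v S b = if b \in Rset v :\: Nset v then S b else 0.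
Proof. exact: seq_mset_filterE. Qed.

(** A cell of R^v has distinct row and column, one being outside [v] and the other inside; off N^v
    the row is therefore strictly smaller, and reversal exchanges the two cases. *)
Lemma star_cell_Nset b : (star_cell b \in Nset (star v)) = (b \in Rset v :\: Nset v).
Proof.
rewrite !inE /= !mem_star negb_and -leqNgt.
case: (boolP (b.1 \in v)) => b1; rewrite /= ?andbF //.
case: (boolP (b.2 \in v)) => b2; rewrite /= ?andbF // andbT.
have ne : b.1 != b.2 :> nat by apply: contraNneq b1 => /val_inj ->.
by have := ltn_ord b.1; have := ltn_ord b.2; lia.
Qed.

Lemma sub_pos_part S : {subset pos_part v S <= Nset v}.
Proof. by move=> b; rewrite in_mset pos_partE; case: ifP. Qed.

Lemma sub_star_neg_part S : {subset star_mon (neg_part v S) <= Nset (star v)}.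
Proof.
move=> b; rewrite in_mset star_monE neg_partE -star_cell_Nset star_cellK.
by case: ifP.
Qed.

Lemma size_parts S : {subset S <= Rset v} ->
  size S = size (pos_part v S) + size (star_mon (neg_part v S)).
Proof.
move=> SR; rewrite !(perm_size (perm_eq_seq_mset _)) size_map.
rewrite (perm_size (perm_eq_seq_mset _)) !size_filter.
rewrite -(count_predC (mem (Nset v))); congr (_ + _).
by apply: eq_in_count => b /SR bR; rewrite /= [in RHS]inE bR andbT.
Qed.

Lemma parts_inj S T : {subset S <= Rset v} -> {subset T <= Rset v} ->
  pos_part v S = pos_part v T ->
  star_mon (neg_part v S) = star_mon (neg_part v T) -> S = T.
Proof.
move=> SR TR /msetP Epos /msetP Eneg; apply/msetP => b.
have [bN|bN] := boolP (b \in Nset v).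
  by have := Epos b; rewrite !pos_partE bN.
have [bR|bR] := boolP (b \in Rset v); last first.
  have out (U : {mset cell n}) : {subset U <= Rset v} -> U b = 0.
    by move=> UR; apply/mset_eq0P; apply: contra bR => /UR.
  by rewrite !out.
by have := Eneg (star_cell b); rewrite !star_monE star_cellK !neg_partE inE bN bR.
Qed.

Lemma parts_surj U W : {subset U <= Nset v} -> {subset W <= Nset (star v)} ->
  exists S : {mset cell n}, [/\ {subset S <= Rset v}, pos_part v S = U
                              & star_mon (neg_part v S) = W].
Proof.
move=> UN WN; exists (U `+` star_mon W).
have E b : (U `+` star_mon W) b = U b + W (star_cell b) by rewrite msetE2 star_monE.
have U0 b : b \notin Nset v -> U b = 0.
  by move=> bN; apply/mset_eq0P; apply: contra bN => /UN.
have W0 b : b \notin Rset v :\: Nset v -> W (star_cell b) = 0.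
  by move=> bN; apply/mset_eq0P; rewrite -star_cell_Nset in bN; apply: contra bN => /WN.
split.
- move=> b; rewrite in_mset E; apply: contraTT => bR; rewrite U0 ?W0 //.
    by rewrite inE (negPf bR) andbF.
  by apply: contra bR; rewrite inE => /andP[].
- apply/msetP => b; rewrite pos_partE E; case: ifP => bN; last by rewrite U0 ?bN.
  by rewrite W0 ?addn0 // inE bN.
apply/msetP => b; rewrite star_monE neg_partE E star_cellK.
case: ifP => bN; first by rewrite U0 //; move: bN; rewrite inE => /andP[].
by rewrite -[b in RHS]star_cellK W0 ?bN.
Qed.

Lemma dominates_pos_part (w : {set 'I_n}) S :
  dominates v w S <-> dominates v w (pos_part v S).
Proof.
split=> dom s /[dup] sv /andP[/allP sN _] sS; apply: dom => // b bs.
  by have := sS b bs; rewrite !in_mset pos_partE; case: ifP.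
have bN : b \in Nset v by exact: sN.
by have := sS b bs; rewrite !in_mset pos_partE bN.
Qed.

End Parts.

(** * Splitting a decreasing sequence at [v] *)

Section StandardSequences.
Variables (n : nat) (v : {set 'I_n}).
Implicit Types (u w : {set 'I_n}) (s P R : seq {set 'I_n}).

Definition below u : bool := leI u v && (u != v).

Lemma above_star u : above (star v) (star u) = below u.
Proof. by rewrite /above /below leI_star (inj_eq (can_inj (@starK n))). Qed.

Lemma below_nabove u : below u -> ~~ above v u.
Proof.
case/andP=> le_uv ne_uv; apply/negP => /andP[le_vu _]; case/negP: ne_uv.
by apply/eqP/leI_anti; rewrite le_uv.
Qed.

Lemma sorted_cat_above_below P R :
  sorted (@geI n) P -> sorted (@geI n) R -> all (above v) P -> all below R ->
  sorted (@geI n) (P ++ R).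
Proof.
rewrite !(sorted_pairwise (@geI_trans n)) pairwise_cat => -> -> /allP aP /allP bR.
rewrite !andbT; apply/allrelP => p r /aP/andP[le_vp _] /bR/andP[le_rv _].
exact: leI_trans le_rv le_vp.
Qed.

Lemma filter_above_cat P R : all (above v) P -> all below R ->
  filter (above v) (P ++ R) = P.
Proof.
move=> aP /allP bR; rewrite filter_cat (all_filterP aP) -[RHS]cats0; congr cat.
by apply/eqP; rewrite -[_ == _]negbK -has_filter -all_predC; apply/allP => r /bR/below_nabove.
Qed.

(** Since [star] reverses the order, the list is reversed as well to remain weakly decreasing. *)
Definition star_rev s := rev [seq star u | u <- s].

Lemma star_revK : involutive star_rev.
Proof. by move=> s; rewrite /star_rev map_rev revK mapK //; apply: starK. Qed.

Lemma sorted_star_rev s : sorted (@geI n) (star_rev s) = sorted (@geI n) s.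
Proof.
rewrite rev_sorted sorted_map; apply: eq_sorted => x y.
by rewrite /= /geI leI_star.
Qed.

Lemma all_below_star_rev s : all below (star_rev s) = all (above (star v)) s.
Proof.
rewrite all_rev all_map; apply: eq_all => u /=.
by rewrite -above_star starK.
Qed.

Lemma sum_vdegree_star_rev s :
  \sum_(u <- star_rev s) vdegree v u = \sum_(u <- s) vdegree (star v) u.
Proof.
rewrite (perm_big _ (permEl (perm_rev _))) /= big_map; apply: eq_bigr => u _.
by rewrite -[in RHS](starK u) vdegree_star.
Qed.

End StandardSequences.

(** * The bijection *)

Lemma main_seqE n (v : {set 'I_n}) (S : {mset cell n}) :
  main_seq v S = pi_tilde v (pos_part v S) ++
                 star_rev (pi_tilde (star v) (star_mon (neg_part v S))).
Proof. by []. Qed.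

Section MainSeq.
Variables (n : nat) (v : {set 'I_n}) (S : {mset cell n}).
Local Notation P := (pi_tilde v (pos_part v S)).
Local Notation R := (star_rev (pi_tilde (star v) (star_mon (neg_part v S)))).

Lemma all_above_main_seq : all (above v) P.
Proof. exact/all_above_pi_tilde/sub_pos_part. Qed.

Lemma all_below_main_seq : all (below v) R.
Proof. by rewrite all_below_star_rev; apply/all_above_pi_tilde/sub_star_neg_part. Qed.

Lemma sorted_main_seq : sorted (@geI n) (main_seq v S).
Proof.
apply: (sorted_cat_above_below (v := v)).
- exact/sorted_pi_tilde/sub_pos_part.
- by rewrite sorted_star_rev; apply/sorted_pi_tilde/sub_star_neg_part.
- exact: all_above_main_seq.
exact: all_below_main_seq.
Qed.

Lemma main_seq_comparable u : u \in main_seq v S ->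
  [/\ #|u| = #|v|, leI u v || leI v u & u != v].
Proof.
rewrite main_seqE mem_cat => /orP[/(allP all_above_main_seq)|/(allP all_below_main_seq)].
  by case/andP=> le ne; rewrite (leI_card le) le orbT.
by case/andP=> le ne; rewrite (leI_card le) le.
Qed.

End MainSeq.

Lemma main_seq_dominated n (v w : {set 'I_n}) (S : {mset cell n}) : leI v w ->
  path (@geI n) w (pi_tilde v (pos_part v S)) ->
  forall u s, main_seq v S = u :: s -> leI u w.
Proof.
move=> le_vw + u s; rewrite main_seqE.
(* If no term is above [v], the first term is below [v], hence below [w]. *)
case E: (pi_tilde v _) => [|p P] /=.
  have := all_below_main_seq v S; case: (star_rev _) => //= r R.
  by case/andP=> /andP[le_rv _] _ _ [<- _]; apply: leI_trans le_rv le_vw.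
by case/andP=> le_pw _ [<- _].
Qed.

Lemma dominates_pathP n (v w : {set 'I_n}) (S : {mset cell n}) : leI v w ->
  dominates v w S <-> path (@geI n) w (pi_tilde v (pos_part v S)).
Proof.
move=> le_vw; have sub := @sub_pos_part n v S.
rewrite dominates_pos_part (dominatesP sub) ?(leI_card le_vw) //.
by split=> /(path_pi_tilde sub le_vw).
Qed.

Theorem mainTheorem3 (d n : nat) (v w : {set 'I_n}) (m : nat)
    (d_gt0 : 0 < d) (le_dn : d <= n)
    (vI : v \in Idn d n) (wI : w \in Idn d n) (le_vw : leI v w) :
  (forall S, Smon v w m S -> sorted (@geI n) (main_seq v S)) /\
  set_bij (Smon v w m) (SM d v w m) (fun S => seq_mset (main_seq v S)).
Proof.
(* A multiset has at most one weakly decreasing arrangement, so equal multisets give equal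
   sequences. *)
have perm_sorted s t : sorted (@geI n) s -> sorted (@geI n) t -> perm_eq s t -> s = t.
  exact: sorted_eq (@geI_trans n) (@geI_anti n) _ _.
split=> [S _|]; first exact: sorted_main_seq.
split.
- move=> S [SR szS domS]; have perm_main := perm_eq_seq_mset (main_seq v S).
  have memE u : u \in seq_mset (main_seq v S) = (u \in main_seq v S).
    exact: perm_mem perm_main u.
  split.
  + split=> [u|]; last by exists (main_seq v S); rewrite perm_sym perm_main sorted_main_seq.
    rewrite memE => /main_seq_comparable[cu _ _]; rewrite inE cu.
    by move: vI; rewrite inE.
  + move=> u s perm_us srt; apply: (@main_seq_dominated _ _ _ S le_vw _ u s).
      exact/dominates_pathP.
    apply: perm_sorted => //; first exact: sorted_main_seq.
    by rewrite perm_sym (perm_trans perm_us).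
  + by move=> u; rewrite memE => /main_seq_comparable[_ -> ->].
  rewrite -szS (size_parts SR) /sm_degree (perm_big _ perm_main) /= main_seqE big_cat /=.
  rewrite sum_vdegree_star_rev !sum_vdegree_pi_tilde //.
  + exact: sub_star_neg_part.
  exact: sub_pos_part.
- move=> S T; rewrite !inE => -[SR _ _] [TR _ _] /eq_seq_msetP perm_ST.
  have := perm_sorted _ _ (sorted_main_seq v S) (sorted_main_seq v T) perm_ST.
  (* Filtering by [above v] recovers the terms from the positive part; cancelling them leaves the
     starred ones. *)
  move=> eqST; have EP := congr1 (filter (above v)) eqST.
  rewrite !main_seqE in EP eqST.
  rewrite !filter_above_cat ?all_above_main_seq ?all_below_main_seq // in EP.
  move/eqP: eqST; rewrite EP eqseq_cat // eqxx /= => /eqP/(can_inj (@star_revK n)) EQ.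
  apply: (parts_inj SR TR).
    exact: pi_tilde_inj (@sub_pos_part _ _ _) (@sub_pos_part _ _ _) EP.
  exact: pi_tilde_inj (@sub_star_neg_part _ _ _) (@sub_star_neg_part _ _ _) EQ.
move=> T [[TI [s [perm_sT srt_s]]] domT compT degT].
have memE u : u \in s = (u \in T) by exact: perm_mem perm_sT u.
(* By compatibility every term is strictly above or strictly below [v], so the two pieces can be
   inverted separately, the second one after [star_rev]. *)
pose P := filter (above v) s; pose R := filter (predC (above v)) s.
have aP : all (above v) P by apply: filter_all.
have bR : all (below v) R.
  apply/allP => u; rewrite mem_filter memE /= => /andP[nau /compT /andP[cmp ne]].
  by move: nau; rewrite /above /below ne !andbT; case/orP: cmp => ->.
have sP : sorted (@geI n) P by apply: sorted_filter srt_s; apply: geI_trans.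
have sR : sorted (@geI n) R by apply: sorted_filter srt_s; apply: geI_trans.
have Es : s = P ++ R.
  apply: perm_sorted => //; first exact: (sorted_cat_above_below (v := v)).
  by rewrite perm_sym; apply: permEl; apply: perm_filterC.
have [U UN EU] := pi_tilde_surj sP aP.
have sQ : sorted (@geI n) (star_rev R) by rewrite sorted_star_rev.
have aQ : all (above (star v)) (star_rev R) by rewrite -all_below_star_rev star_revK.
have [W WN EW] := pi_tilde_surj sQ aQ.
have [S [SR ES1 ES2]] := parts_surj UN WN.
have Emain : main_seq v S = s by rewrite main_seqE ES1 ES2 EU EW star_revK.
have ET : seq_mset (main_seq v S) = T.
  by rewrite Emain -[RHS]seq_mset_id; apply/eq_seq_msetP.
exists S => //; split=> //.
  rewrite (size_parts SR) -degT -ET /sm_degree (perm_big _ (perm_eq_seq_mset _)) /=.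
  rewrite main_seqE big_cat /= sum_vdegree_star_rev !sum_vdegree_pi_tilde //.
    exact: sub_star_neg_part.
  exact: sub_pos_part.
(* If [P] is empty the path condition is vacuous; otherwise its head is the first term of the whole
   sequence, which [domT] bounds by [w]. *)
apply/(dominates_pathP _ le_vw); rewrite ES1 EU.
case EP: P sP => [|p P'] //= sP; rewrite sP andbT.
apply: (domT p (P' ++ R)); first by rewrite -cat_cons -EP -Es.
by rewrite -cat_cons -EP -Es.
Qed.
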